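(* Let $\alpha\in(0,1)$, let $T:\mathbb{S}\to\mathbb{S}$ be the intermittent circle map with parameter $\alpha$, and let $(\theta_\varepsilon)_{\varepsilon>0}$ be a family of absolutely continuous probability measures with $\operatorname{supp}\theta_\varepsilon\subset[-\varepsilon,\varepsilon]$, defining the additive random perturbation $T_t=T+t$. For each $\varepsilon$ let $\mu^\varepsilon$ be the stationary probability measure of this random system. If $\mu_0$ is any weak$^*$ accumulation point of $(\mu^\varepsilon)_{\varepsilon>0}$ when $\varepsilon\to0$, then $\mu_0\in\mathbb{E}$, where $$\mathbb{E}=\{t\delta_0+(1-t)\mu_{SRB}:0\le t\le1\}.$$
   Context: $\mathbb{S}=[0,1]/\{0\sim1\}$ is the circle with normalized Lebesgue measure $m$. The intermittent map with parameter $\alpha>0$ is $T(x)=x+2^{\alpha}x^{1+\alpha}$ for $x\in[0,1/2)$ and $T(x)=x-2^{\alpha}(1-x)^{1+\alpha}$ for $x\in[1/2,1]$; it defines a $C^{1+\alpha}$ map of $\mathbb{S}$ with fixed point $0$ and $DT(0)=1$. For $\alpha\in(0,1)$, $T$ has a unique absolutely continuous (with respect to $m$) invariant probability measure, denoted $\mu_{SRB}$. $\delta_0$ is the Dirac mass at $0$. Additive perturbation: for $|t|\le 1/2$ let $T_t(x)=T(x)+t \pmod 1$. For small $\varepsilon>0$ (say $\varepsilon\le1/2$), $\theta_\varepsilon$ is a probability measure on the parameter interval $[-1/2,1/2]$, absolutely continuous with respect to Lebesgue measure, with support contained in $[-\varepsilon,\varepsilon]$. A Borel probability measure $\mu^\varepsilon$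 on $\mathbb{S}$ is stationary for the random system if $\int\!\int\varphi(T_t(x))\,d\mu^\varepsilon(x)\,d\theta_\varepsilon(t)=\int\varphi\,d\mu^\varepsilon$ for all continuous $\varphi:\mathbb{S}\to\mathbb{R}$. In this setting a stationary probability measure $\mu^\varepsilon$ exists for every $\varepsilon$, is ergodic, and is the unique absolutely continuous stationary probability measure. *)

(* Defs.v *)
(* MathComp-Analysis *)
From HB Require Import structures.
From mathcomp Require Import all_boot all_order all_algebra.
From mathcomp Require Import generic_quotient.
From mathcomp Require Import all_classical all_reals all_analysis.

Set Implicit Arguments.
Unset Strict Implicit.
Unset Printing Implicit Defensive.

Import Order.TTheory GRing.Theory Num.Theory.
Import numFieldNormedType.Exports.

Local Open Scope classical_set_scope.
Local Open Scope ring_scope.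
Local Open Scope quotient_scope.

Section circle.
Context {R : realType}.

Let circle_rel' (x y : R) : bool := x - y \is a Num.int.

Local Lemma circle_rel_refl : reflexive circle_rel'.
Proof. by move=> x; rewrite /circle_rel' subrr rpred0. Qed.

Local Lemma circle_rel_sym : symmetric circle_rel'.
Proof. by move=> x y; rewrite /circle_rel' -opprB rpredN. Qed.

Local Lemma circle_rel_trans : transitive circle_rel'.
Proof.
move=> y x z; rewrite /circle_rel' => xy yz.
by rewrite -(subrKA y) rpredD.
Qed.

Definition circle_rel :=
  EquivRel circle_rel' circle_rel_refl circle_rel_sym circle_rel_trans.

End circle.

(* The circle [0,1]/{0 ~ 1}, presented as R/Z, with the quotient topology and
   its Borel sigma-algebra. *)
Definition circle (R : realType) := {eq_quot @circle_rel R}.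

HB.instance Definition _ (R : realType) :=
  PointedTopological.copy (circle R) (quotient_topology (circle R)).
HB.instance Definition _ (R : realType) := Quotient.on (circle R).
HB.instance Definition _ (R : realType) :=
  Measurable.copy (circle R)
    (g_sigma_algebraType (@open (quotient_topology (circle R)))).

Definition circle_proj {R : realType} (x : R) : circle R := \pi_(circle R) x.

(* The representative in [0, 1[. *)
Definition circle_coord {R : realType} (x : circle R) : R :=
  repr x - (Num.floor (repr x))%:~R.

Definition circle_lebesgue {R : realType} : set (circle R) -> \bar R :=
  pushforward (mrestr (@lebesgue_measure R) (measurable_itv `[0, 1])) circle_proj.

Definition intermittent_fun {R : realType} (alpha : R) (x : R) : R :=
  if x < 2^-1 then x + 2 `^ alpha * x `^ (1 + alpha)
  else x - 2 `^ alpha * (1 - x) `^ (1 + alpha).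

Definition intermittent_map {R : realType} (alpha : R) (x : circle R) :
    circle R :=
  circle_proj (intermittent_fun alpha (circle_coord x)).

Definition perturbed_map {R : realType} (T : circle R -> circle R) (t : R)
    (x : circle R) : circle R :=
  circle_proj (circle_coord (T x) + t).

Definition invariant_measure {d} {X : measurableType d} {R : realType}
    (T : X -> X) (mu : probability X R) : Prop :=
  forall A, measurable A -> mu (T @^-1` A) = mu A.

Definition acip {R : realType} (T : circle R -> circle R)
    (mu : probability (circle R) R) : Prop :=
  invariant_measure T mu /\ mu `<< circle_lebesgue.

(* Records may carry the same measure without being equal (they may differ on
   non-measurable sets), hence equality is tested on measurable sets. *)
Definition unique_acip {R : realType} (T : circle R -> circle R)
    (mu : probability (circle R) R) : Prop :=
  acip T mu /\
  forall nu : probability (circle R) R, acip T nu ->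
    forall A, measurable A -> nu A = mu A.

Definition measure_support {R : realType}
    (theta : probability (measurableTypeR R) R) : set R :=
  [set t | forall U : set R, open U -> U t -> (0 < theta U)%E].

Definition stationary {R : realType} (T : circle R -> circle R)
    (theta : probability (measurableTypeR R) R)
    (mu : probability (circle R) R) : Prop :=
  forall phi : circle R -> R, continuous phi ->
    \int[theta]_t (\int[mu]_x phi (perturbed_map T t x)) = \int[mu]_x phi x.

Definition integral_functional {R : realType} (mu : probability (circle R) R) :
    {ptws continuousType (circle R) R -> R} :=
  fun phi => \int[mu]_x phi x.

(* Borel probability measures on the circle with the weak-* topology: the
   coarsest one making every mu |-> \int phi dmu, phi continuous, continuous. *)
Definition weak_star (R : realType) :=
  initial_topology (@integral_functional R).

HB.instance Definition _ (R : realType) := Topological.on (weak_star R).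

Definition dirac_srb_segment {R : realType} (muSRB : probability (circle R) R) :
    set (probability (circle R) R) :=
  [set mu | exists2 t : R, 0 <= t <= 1 &
     forall A, measurable A ->
       mu A = (t%:E * \d_(circle_proj (0 : R)) A + (1 - t)%:E * muSRB A)%E].

(* Main.v *)
Require Import Defs.
From HB Require Import structures.
From mathcomp Require Import all_boot all_order all_algebra.
From mathcomp Require Import all_classical all_reals all_analysis.
From mathcomp Require Import generic_quotient measurable_realfun ring lra.

(** Write T_t for T + t.  The heart of the matter is that stationary measures
    have a density bounded away from the fixed point 0, uniformly in the noise.
    Granted this, a limit mu0 of stationary measures does not charge the
    Lebesgue-null subsets of the circle minus 0 ([null_off_zero]), and it is
    invariant ([limit_invariant]).  As 0 is fixed, the part of mu0 off 0 is
    invariant too; once normalized it is an absolutely continuous invariant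
    probability measure, hence muSRB, and mu0 is a mixture of the Dirac mass at
    0 and of muSRB.

    The density bound is proved by duality, on test functions.  Let psi be a C1
    function on the circle, with derivative phi, such that
    |psi(y)| <= max(|y|, r) for some small r > 0.  The function psi o T_t / T'
    has derivative phi o T_t - (T''/T'^2) psi o T_t, and because
    T(x) <= T'(x) (x - 2 gain x (2x)^alpha) on [0,1/2] ([slopeV_branch_le]) it
    satisfies the same bound as psi, with room to spare outside ]-r, r[.  Its
    two defects, that T''/T'^2 blows up at 0 and that the two branches do not
    match at 1/2, are cured by local corrections ([half_transfer]).  Hence
    phi o T_t is, up to an error at most [step_error r], the derivative of a
    function under the same bound, and the room to spare accommodates one more
    summand: a small function psi0 supported away from 0 ([transfer_step]).
    Nothing here depends on the noise, once it is small enough given r.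

    Iterate N times from psi = 0, against a stationary measure mu, each time
    with a translation t for which the integral of phi o T_t is almost at least
    that of phi ([stationary_shift]).  This gives phi_N with primitive bounded by
    1, with sup norm O(N), and with integral at least
    N (int psi0' dmu - step_error r - 1).  By stationarity the latter integral is
    an average of the integrals of t |-> phi_N(y + t) against the law of the
    noise; these are o(N), since phi_N oscillates and the noise has a density
    ([absolutely_continuous_oscillation]).  Therefore
    int psi0' dmu <= step_error r + 1 ([stationary_C1_bound]).  Choosing for psi0
    a multiple of atan((x - c)/h), cut off near 0, whose derivative is of order
    1/h on [c - h, c + h], one finds mu [c - h, c + h] <= K h in the limit
    ([limit_interval_bound]). *)

Set Implicit Arguments.
Unset Strict Implicit.
Unset Printing Implicit Defensive.

Import Order.TTheory GRing.Theory Num.Theory.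
Import numFieldNormedType.Exports.

Local Open Scope classical_set_scope.
Local Open Scope ring_scope.

(** * Derivatives and primitives on the line *)

Lemma eq_of_is_derive (R : realType) (f g df : R -> R) (a b c : R) :
  {in `[a, b], continuous f} -> {in `[a, b], continuous g} ->
  (forall x, a < x < b -> is_derive x 1 f (df x)) ->
  (forall x, a < x < b -> is_derive x 1 g (df x)) ->
  c \in `[a, b] -> f c = g c -> {in `[a, b], f =1 g}.
Proof.
move=> cf cg df' dg' cab fgc x xab.
have key u v : u \in `[a, b] -> v \in `[a, b] -> u < v ->
    f v - g v = f u - g u.
  move=> uab vab uv.
  have [||z _] := @MVT _ (f - g) (fun=> 0) u v uv.
  - move=> z; rewrite in_itv/= => /andP[uz zv].
    have zab : a < z < b.
      move: uab vab; rewrite !in_itv/= => /andP[au _] /andP[_ vb].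
      by rewrite (le_lt_trans au)// (lt_le_trans zv).
    have := df' _ zab; have := dg' _ zab => ? ?.
    by apply: is_derive_eq; rewrite subrr.
  - apply: continuous_in_subspaceT => z; rewrite inE/= in_itv/= => /andP[uz zv].
    have zab : z \in `[a, b].
      move: uab vab; rewrite !in_itv/= => /andP[au _] /andP[_ vb].
      by rewrite (le_trans au)// (le_trans zv).
    by apply: continuousB; [exact: cf|exact: cg].
  - by rewrite mul0r => /subr0_eq.
have [xc|cx|->//] := ltgtP x c.
- by have := key _ _ xab cab xc; rewrite fgc subrr => /esym/subr0_eq.
- by have := key _ _ cab xab cx; rewrite fgc subrr => /subr0_eq.
Qed.

Lemma is_derive_continuous (R : realType) (f : R -> R) (x d : R) :
  is_derive x 1 f d -> {for x, continuous f}.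
Proof.
move=> dfx; apply: differentiable_continuous; exact/derivable1_diffP.
Qed.

Section derivation_rules.
Context {R : realType}.
Implicit Types (f g : R -> R) (x a b c : R).

Lemma is_derive1D f g x a b : is_derive x 1 f a -> is_derive x 1 g b ->
  is_derive x 1 (fun y => f y + g y) (a + b).
Proof. exact: is_deriveD. Qed.

Lemma is_derive1B f g x a b : is_derive x 1 f a -> is_derive x 1 g b ->
  is_derive x 1 (fun y => f y - g y) (a - b).
Proof. exact: is_deriveB. Qed.

Lemma is_derive1M f g x a b : is_derive x 1 f a -> is_derive x 1 g b ->
  is_derive x 1 (fun y => f y * g y) (a * g x + f x * b).
Proof.
move=> fa gb; have := is_deriveM fa gb.
suff -> : a * g x + f x * b = f x *: b + g x *: a by [].
by rewrite addrC (mulrC a).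
Qed.

Lemma is_derive1Mc f x a c : is_derive x 1 f a ->
  is_derive x 1 (fun y => c * f y) (c * a).
Proof. by move=> fa; exact: is_deriveZ. Qed.

Lemma is_derive1_c c x : is_derive x 1 (fun _ : R => c) 0.
Proof. exact: is_derive_cst. Qed.

Lemma is_derive1V f x a : f x != 0 -> is_derive x 1 f a ->
  is_derive x 1 (fun y => (f y)^-1) (- a / f x ^+ 2).
Proof.
move=> fx fa; have := is_deriveV fx fa.
suff -> : - a / f x ^+ 2 = - (f x) ^- 2 *: a by [].
by rewrite scaleNr mulNr mulrC.
Qed.

Lemma is_derive1o f g x a b : is_derive (g x) 1 f a -> is_derive x 1 g b ->
  is_derive x 1 (fun y => f (g y)) (a * b).
Proof. exact: is_derive1_comp. Qed.

Lemma is_derive1_id x : is_derive x 1 (fun y : R => y) 1.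
Proof. exact: is_derive_id. Qed.

Lemma is_derive1_affine a b x : is_derive x 1 (fun y => a * y + b) a.
Proof.
have := is_derive1D (is_derive1Mc a (is_derive1_id x)) (is_derive1_c b x).
by rewrite mulr1 addr0.
Qed.

End derivation_rules.

(** An integral with lower end - n is differentiated only to the right of
    - n: the primitives started at - n and normalized at 0 are patched
    together, and they agree wherever two of them are defined. *)
Lemma primitive (R : realType) (f : R -> R) : continuous f ->
  exists F : R -> R, F 0 = 0 /\ forall x : R, is_derive x 1 F (f x).
Proof.
move=> cf.
have ifab (a b : R) : (@lebesgue_measure R).-integrable `[a, b] (EFin \o f).
  apply: continuous_compact_integrable; first exact: segment_compact.
  exact: continuous_subspaceT.
pose G (n : nat) (x : R) := parameterized_integral (@lebesgue_measure R) (- n%:R) x f.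
have dG n (x : R) : - n%:R < x -> is_derive x 1 (G n) (f x).
  move=> nx.
  have [||d1 d2] := @continuous_FTC1_closed R f (- n%:R) x (x + 1) _ (ifab _ _) nx.
  - by rewrite ltrDl.
  - exact: cf.
  by apply: DeriveDef; [exact: d1|rewrite -d2 derive1E].
pose H n x := G n x - G n 0.
have dH n (x : R) : - n%:R < x -> is_derive x 1 (H n) (f x).
  move=> nx; have := is_derive1B (dG _ _ nx) (is_derive1_c (G n 0) x).
  by rewrite subr0.
have HE n m (x : R) : (0 < n)%N -> (n <= m)%N -> - n%:R < x -> H n x = H m x.
  move=> n0 nm nx.
  have n0' : (0 : R) < n%:R by rewrite ltr0n.
  pose a := (Num.min x 0 - n%:R) / 2; pose b := `|x| + 1.
  have an : - n%:R < a by rewrite /a /Num.min; case: ifP; lra.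
  have mn y : a <= y -> - n%:R < y by move=> ?; rewrite (lt_le_trans an).
  have mm y : a <= y -> - m%:R < y.
    by move=> /mn; apply: le_lt_trans; rewrite lerN2 ler_nat.
  apply: (@eq_of_is_derive R (H n) (H m) f a b 0).
  - move=> y; rewrite in_itv/= => /andP[/mn/dH ? _].
    by apply: is_derive_continuous.
  - move=> y; rewrite in_itv/= => /andP[/mm/dH ? _].
    by apply: is_derive_continuous.
  - by move=> y /andP[/ltW/mn/dH].
  - by move=> y /andP[/ltW/mm/dH].
  - by rewrite in_itv/= /a /b; have := normr_ge0 x; rewrite /Num.min; case: ifP; lra.
  - by rewrite /H !subrr.
  - have := ler_norm x; rewrite in_itv/= /a /b.
    by rewrite /Num.min; case: ifP; have := normr_ge0 x; lra.
pose N (x : R) := (Num.trunc `|x|).+1.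
have Nx (x : R) : - (N x)%:R < x.
  have := truncnS_gt `|x|; rewrite -/(N x) => h.
  by rewrite ltrNl (le_lt_trans _ h)// -normrN ler_norm.
exists (fun x => H (N x) x); split; first by rewrite /H subrr.
move=> x; apply: (@near_eq_is_derive _ _ _ (H (N x).+1)); last first.
  by apply: dH; rewrite (le_lt_trans _ (Nx x))// lerN2 ler_nat.
near=> y.
apply/esym; apply: HE => //.
rewrite /N ltnS.
rewrite truncn_le_nat.
have := truncnS_gt `|x|.
have : `|y - x| < 1.
  by near: y; apply: cvgr_distC_lt => //; exact: cvg_id.
have := ler_normD (y - x) x; rewrite subrK.
rewrite -[(Num.trunc _).+2%:R]natr1; lra.
Unshelve. all: by end_near. Qed.

Lemma is_derive_maxr0_sqr (R : realType) (s : R) :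
  is_derive s 1 (fun s : R => Num.max 0 s ^+ 2) (2 * Num.max 0 s).
Proof.
have [s0|s0|->] := ltgtP s 0.
- rewrite mulr0.
  apply: (@near_eq_is_derive _ _ _ (cst 0)) => //.
  near=> y; rewrite max_l ?expr0n//=.
  by apply: ltW; near: y; exact: lt_nbhsl.
- apply: (@near_eq_is_derive _ _ _ (fun x : R => x * x)).
    near=> y; rewrite max_r ?expr2//.
    by apply: ltW; near: y; exact: lt_nbhsr.
  have -> : 2 * s = 1 * s + s * 1 by ring.
  exact: is_derive1M (is_derive1_id s) (is_derive1_id s).
- rewrite mulr0.
  have h : (fun h : R => h^-1 *: ((fun s : R => Num.max 0 s ^+ 2) (h *: 1 + 0) -
       (fun s : R => Num.max 0 s ^+ 2) 0)) @ 0^' --> (0 : R).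
    rewrite /= maxxx expr0n/=.
    apply/cvgr0Pnorm_le => e e0.
    near=> z.
    have z0 : z != 0 by near: z; exact: nbhs_dnbhs_neq.
    have ze : `|z| <= e.
      by near: z; exact: dnbhs0_le.
    rewrite subr0 addr0 [z%:A]mulr1.
    rewrite normrM normfV ler_pdivrMl ?normr_gt0//.
    rewrite expr2 normrM.
    rewrite mulrC.
    have : `|Num.max 0 z| <= `|z| by rewrite /Num.max; case: ifP; rewrite ?normr0.
    have := normr_ge0 (Num.max 0 z).
    nra.
  apply: DeriveDef; first by apply/cvg_ex; exists 0.
  exact: cvg_lim h.
Unshelve. all: by end_near. Qed.

(** * Continuous periodic functions *)

Section continuity_rules.
Context {R : realType}.
Implicit Types (f g : R -> R) (c : R).

Lemma contD f g : continuous f -> continuous g ->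
  continuous (fun y => f y + g y).
Proof. by move=> cf cg x; apply: cvgD; [exact: cf|exact: cg]. Qed.

Lemma contN f : continuous f -> continuous (fun y => - f y).
Proof. by move=> cf x; apply: cvgN; exact: cf. Qed.

Lemma contB f g : continuous f -> continuous g ->
  continuous (fun y => f y - g y).
Proof. by move=> cf cg; apply: contD => //; exact: contN. Qed.

Lemma contM f g : continuous f -> continuous g ->
  continuous (fun y => f y * g y).
Proof. by move=> cf cg x; apply: cvgM; [exact: cf|exact: cg]. Qed.

Lemma contV f : continuous f -> (forall x, f x != 0) ->
  continuous (fun y => (f y)^-1).
Proof. by move=> cf f0 x; apply: cvgV => //; exact: cf. Qed.

Lemma cont_comp f g : continuous f -> continuous g ->
  continuous (fun y => f (g y)).
Proof. by move=> cf cg x; apply: (continuous_comp (cg x)); exact: cf. Qed.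

Lemma cont_cst c : continuous (fun _ : R => c).
Proof. exact: cst_continuous. Qed.

Lemma cont_id : continuous (fun y : R => y).
Proof. by move=> x; exact: cvg_id. Qed.

Lemma cont_min f g : continuous f -> continuous g ->
  continuous (fun y => Num.min (f y) (g y)).
Proof. by move=> cf cg x; apply: continuous_min; [exact: cf|exact: cg]. Qed.

Lemma cont_max f g : continuous f -> continuous g ->
  continuous (fun y => Num.max (f y) (g y)).
Proof. by move=> cf cg x; apply: continuous_max; [exact: cf|exact: cg]. Qed.

Lemma cont_exp f n : continuous f -> continuous (fun y => f y ^+ n).
Proof.
move=> cf; elim: n => [|n IH]; first exact: cst_continuous.
by under eq_fun do rewrite exprS; exact: contM.
Qed.

Lemma cont_norm f : continuous f -> continuous (fun y => `|f y|).
Proof.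
move=> cf x; apply: (@continuous_comp _ _ _ f (fun y : R => `|y|)).
  exact: cf.
exact: norm_continuous.
Qed.

End continuity_rules.

(** Descends through the arithmetic of a continuous real function, leaving as
    goals the leaves that are not hypotheses. *)
Ltac solve_cont :=
  first [assumption | lazymatch goal with
  | R0 : realType |- forall x, continuous_at x ?h => lazymatch h with
    | (fun _ => ?c) => exact: cst_continuous
    | (fun y => y) => exact: cont_id
    | (fun y => @Algebra.add _ (@?f y) (@?g y)) =>
        apply: (@contD R0 f g); solve_cont
    | (fun y => @Algebra.opp _ (@?f y)) => apply: (@contN R0 f); solve_cont
    | (fun y => @GRing.mul _ (@?f y) (@?g y)) =>
        apply: (@contM R0 f g); solve_cont
    | (fun y => @Order.min _ _ (@?f y) (@?g y)) =>
        apply: (@cont_min R0 f g); solve_cont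
    | (fun y => @Order.max _ _ (@?f y) (@?g y)) =>
        apply: (@cont_max R0 f g); solve_cont
    | (fun y => @GRing.exp _ (@?f y) ?n) =>
        apply: (@cont_exp R0 f n); solve_cont
    | _ => idtac
    end
  | |- _ => idtac
  end].

Definition frac_part (R : realType) (x : R) : R := x - (Num.floor x)%:~R.

Lemma frac_part_itv (R : realType) (x : R) : 0 <= frac_part x < 1.
Proof.
by have := floor_itv x; rewrite intrD /frac_part; lra.
Qed.

Lemma frac_part_id (R : realType) (x : R) : 0 <= x < 1 -> frac_part x = x.
Proof.
move=> x01; rewrite /frac_part (_ : Num.floor x = 0) ?subr0//.
by apply: floor_def; rewrite add0r.
Qed.

Lemma frac_partDz (R : realType) (x : R) (n : int) :
  frac_part (x + n%:~R) = frac_part x.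
Proof.
rewrite /frac_part floorDrz ?intr_int// intrD.
by rewrite intrKfloor; ring.
Qed.

Definition periodic1 (R : realType) (f : R -> R) := forall x, f (x + 1) = f x.

Lemma periodic1z (R : realType) (f : R -> R) (x : R) (n : int) :
  periodic1 f -> f (x + n%:~R) = f x.
Proof.
move=> pf.
have pn (m : nat) y : f (y + m%:R) = f y.
  elim: m y => [|m IH] y; first by rewrite addr0.
  by rewrite -natr1 addrA pf.
case: n => m; first by rewrite -pmulrn pn.
by rewrite NegzE mulrNz -pmulrn -[in RHS](subrK m.+1%:R x) pn.
Qed.

Lemma periodic1_frac (R : realType) (f : R -> R) (x : R) :
  periodic1 f -> f (frac_part x) = f x.
Proof. by move=> pf; rewrite /frac_part -mulrNz periodic1z. Qed.

(** Near an integer n the composite agrees with a function in which the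
    two one-sided pieces of [h], near 1 and near 0, are clamped and added. *)
Lemma continuous_frac_extension (R : realType) (h : R -> R) :
  continuous h -> h 0 = h 1 -> continuous (fun x => h (frac_part x)).
Proof.
move=> ch h01 x.
pose n := Num.floor x.
pose H (y : R) := h (Num.min (y - (n%:~R - 1)) 1) + h (Num.max (y - n%:~R) 0) - h 0.
have cH : continuous H.
  apply: contB; last exact: cont_cst.
  by apply: contD; apply: cont_comp => //; solve_cont.
have HE (y : R) : n%:~R - 1 < y < n%:~R + 1 -> h (frac_part y) = H y.
  move=> yn; rewrite /H; have [yln|ngty] := ltP y n%:~R.
    rewrite [Num.max _ _]max_r; last by lra.
    rewrite addrK min_l; last by lra.
    congr h; rewrite /frac_part (_ : Num.floor y = n - 1).
      by rewrite intrB.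
    by apply: floor_def; rewrite subrK intrB; lra.
  rewrite [Num.max _ _]max_l; last by lra.
  rewrite min_r; last by lra.
  rewrite -h01 [h 0 + _]addrC addrK.
  congr h; rewrite /frac_part (_ : Num.floor y = n)//.
  by apply: floor_def; rewrite intrD; lra.
have xn : n%:~R - 1 < x < n%:~R + 1.
  by have := floor_itv x; rewrite -/n intrD; lra.
have near_x : \forall y \near x, H y = h (frac_part y).
  near=> y; apply/esym/HE; apply/andP; split.
    by near: y; apply: lt_nbhsr; case/andP: xn.
  by near: y; apply: lt_nbhsl; case/andP: xn.
rewrite /continuous_at (HE _ xn).
apply: cvg_trans (cH x); apply: near_eq_cvg.
exact: near_x.
Unshelve. all: by end_near. Qed.

(** The right half is parametrized by the distance to 1: the map commutes
    with x |-> 1 - x, so the two halves are given by the same formulas. *)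
Lemma continuous_glue (R : realType) (c1 c2 : R -> R) :
  continuous c1 -> continuous c2 -> c1 0 = c2 0 -> c1 2^-1 = c2 2^-1 ->
  exists c : R -> R, [/\ continuous c, periodic1 c,
    forall x : R, 0 <= x <= 2^-1 -> c x = c1 x &
    forall x : R, 2^-1 <= x <= 1 -> c x = c2 (1 - x)].
Proof.
move=> cc1 cc2 e0 e12.
pose h (x : R) := c1 (Num.min x 2^-1) + c2 (1 - Num.max x 2^-1) - c1 2^-1.
have hl x : x <= 2^-1 -> h x = c1 x.
  move=> x2; rewrite /h min_l// max_r//.
  by rewrite (_ : 1 - 2^-1 = 2^-1) ?e12 ?addrK//; lra.
have hr x : 2^-1 <= x -> h x = c2 (1 - x).
  by move=> x2; rewrite /h min_r// max_l// [c1 _ + _]addrC addrK.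
have ch : continuous h.
  apply: contB; last exact: cont_cst.
  by apply: contD; apply: cont_comp => //; solve_cont.
have h01 : h 0 = h 1.
  by rewrite hl ?hr ?subrr//; lra.
have cE x : 0 <= x <= 1 -> h (frac_part x) = h x.
  move=> /andP[x0]; rewrite le_eqVlt => /orP[/eqP->|x1].
    rewrite -h01 /frac_part -[X in Num.floor X]add0r floorDrz ?floor0//.
    by rewrite add0r floor1 subrr.
  by rewrite frac_part_id// x0.
exists (fun x => h (frac_part x)); split.
- exact: continuous_frac_extension.
- by move=> x; rewrite -[X in x + X]/(1%:~R) frac_partDz.
- by move=> x x01; rewrite cE ?hl//; lra.
- by move=> x x01; rewrite cE ?hr//; lra.
Qed.

(** A C1 function on the circle is a 1-periodic C1 function on the line; its
    derivative is kept next to it because the iteration acts on derivatives. *)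
Definition C1circle (R : realType) (psi phi : R -> R) :=
  [/\ periodic1 psi, continuous phi, periodic1 phi &
      forall x : R, is_derive x 1 psi (phi x)].

(** The glued function is the primitive of the glued derivatives, so that no
    differentiability has to be checked at the junctions 0 and 1/2. *)
Lemma C1circle_glue (R : realType) (a1 d1 a2 d2 : R -> R) :
  continuous a1 -> continuous a2 -> continuous d1 -> continuous d2 ->
  (forall x : R, 0 < x < 2^-1 -> is_derive x 1 a1 (d1 x)) ->
  (forall x : R, 0 < x < 2^-1 -> is_derive x 1 a2 (d2 x)) ->
  a1 0 = a2 0 -> a1 2^-1 = a2 2^-1 ->
  d1 0 = - d2 0 -> d1 2^-1 = - d2 2^-1 ->
  exists psi phi : R -> R, [/\ C1circle psi phi,
    forall x : R, 0 <= x <= 2^-1 -> psi x = a1 x /\ phi x = d1 x &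
    forall x : R, 2^-1 <= x <= 1 -> psi x = a2 (1 - x) /\ phi x = - d2 (1 - x)].
Proof.
move=> ca1 ca2 cd1 cd2 dd1 dd2 a0 a12 d0 d12.
have [phi [cphi pphi phi1 phi2]] := continuous_glue cd1 (contN cd2) d0 d12.
have [F [F0 dF]] := primitive cphi.
pose psi x := F x + a1 0.
have dpsi (x : R) : is_derive x 1 psi (phi x).
  by have := is_derive1D (dF x) (is_derive1_c (a1 0) x); rewrite addr0.
have cpsi : continuous psi by move=> x; exact: is_derive_continuous (dpsi x).
(* Both sides have the same derivative and the same value at 0. *)
have psi1 (x : R) : 0 <= x <= 2^-1 -> psi x = a1 x.
  move=> x01; apply: (@eq_of_is_derive R psi a1 phi 0 2^-1 0).
  - by move=> y _; exact: cpsi.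
  - by move=> y _; exact: ca1.
  - by move=> y y01; rewrite phi1; [exact: dd1|lra].
  - by rewrite in_itv/=; lra.
  - by rewrite /psi F0 add0r.
  - by rewrite in_itv/=.
have psi2 (x : R) : 2^-1 <= x <= 1 -> psi x = a2 (1 - x).
  move=> x01; have c1x : continuous (fun x : R => 1 - x) by solve_cont.
  apply: (@eq_of_is_derive R psi (fun x => a2 (1 - x)) phi 2^-1 1 2^-1).
  - by move=> y _; exact: cpsi.
  - by move=> y _; exact: (cont_comp ca2 c1x).
  - move=> y y01; rewrite phi2; last by lra.
    have dy : is_derive (1 - y) 1 a2 (d2 (1 - y)) by apply: dd2; lra.
    have := @is_derive1o R a2 (fun y => 1 - y) _ _ _ dy (is_derive1B (is_derive1_c 1 y) (is_derive1_id y)).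
    by rewrite sub0r mulrN1.
  - by rewrite in_itv/=; lra.
  - by rewrite psi1 ?a12; [congr a2|]; lra.
  - by rewrite in_itv/=.
exists psi, phi; split.
- split=> //.
  move=> x.
  pose psi' y := psi (y + 1).
  have dpsi' (y : R) : is_derive y 1 psi' (phi y).
    have := @is_derive1o R psi (fun y => y + 1) _ _ _ (dpsi (y + 1)) (is_derive1D (is_derive1_id y) (is_derive1_c 1 y)).
    by rewrite addr0 mulr1 pphi.
  have nx := ler_norm x; have nx' := ler_norm (- x); rewrite normrN in nx'.
  have := normr_ge0 x => x0.
  (* Periodicity: translating by 1 preserves the derivative and the value at 0. *)
  apply: (@eq_of_is_derive R psi' psi phi (- `|x| - 1) (`|x| + 1) 0).
  - by move=> y _; exact: is_derive_continuous (dpsi' y).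
  - by move=> y _; exact: cpsi.
  - by rewrite in_itv/=; lra.
  - by rewrite /psi' add0r (psi2 1) ?subrr ?(psi1 0) ?a0 //; lra.
  - by rewrite in_itv/=; lra.
- by move=> x x01; rewrite psi1 ?phi1.
- by move=> x x01; rewrite psi2 ?phi2.
Qed.

(** * Cutoff functions and the branches of the map *)

Section bump.
Context {R : realType}.
Implicit Types (u x : R).

Definition bump u : R := Num.max 0 (1 - u ^+ 2) ^+ 2.
Definition dbump u : R := - 4 * u * Num.max 0 (1 - u ^+ 2).

Lemma is_derive_bump u : is_derive u 1 bump (dbump u).
Proof.
have d1 := is_derive1B (is_derive1_c 1 u) (is_derive1M (is_derive1_id u) (is_derive1_id u)).
have := @is_derive1o R (fun s => Num.max 0 s ^+ 2) (fun y => 1 - y * y) _ _ _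
  (is_derive_maxr0_sqr _) d1.
have -> : 2 * Num.max 0 (1 - u * u) * (0 - (1 * u + u * 1)) = dbump u.
  by rewrite /dbump expr2; ring.
by rewrite /bump; under eq_fun do rewrite -expr2.
Qed.

Lemma continuous_bump : continuous bump.
Proof. by move=> u; exact: is_derive_continuous (is_derive_bump u). Qed.

Lemma continuous_dbump : continuous dbump.
Proof.
by rewrite /dbump; solve_cont.
Qed.

Lemma bump_itv u : 0 <= bump u <= 1.
Proof.
rewrite /bump sqr_ge0/= expr_le1//; last by rewrite le_max lexx.
by rewrite ge_max ler01/=; have := sqr_ge0 u; lra.
Qed.

Lemma bump_ge1 u : 1 <= `|u| -> bump u = 0 /\ dbump u = 0.
Proof.
move=> u1; rewrite /bump /dbump max_l ?expr0n ?mulr0//.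
by rewrite subr_le0 -real_normK ?num_real// expr_ge1.
Qed.

Lemma bump0 : bump 0 = 1 /\ dbump 0 = 0.
Proof.
by rewrite /bump /dbump expr0n/= subr0 max_r// expr1n mulr0 mul0r.
Qed.

Lemma dbump_le u : `|dbump u| <= 4.
Proof.
have [u1|/ltW/bump_ge1[_ ->]] := leP `|u| 1; last by rewrite normr0.
rewrite /dbump 2!normrM normrN (ger0_norm (_ : 0 <= 4))//.
have : `|Num.max 0 (1 - u ^+ 2)| <= 1.
  rewrite ger0_norm ?le_max ?lexx// ge_max ler01/=.
  by have := sqr_ge0 u; lra.
have := normr_ge0 (Num.max 0 (1 - u ^+ 2)); have := normr_ge0 u; nra.
Qed.

(** The quotient (1 - bump u) / u, written without a division by 0.  It is
    bounded, so that 1 - bump supplies a factor u able to absorb a division by x. *)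
Definition ebump u : R := u / Num.max 1 (u ^+ 2) * (1 + Num.max 0 (1 - u ^+ 2)).

Lemma ebumpE u : 1 - bump u = u * ebump u.
Proof.
rewrite /ebump /bump; have [u1|u1] := leP (u ^+ 2) 1.
  rewrite max_r; last by lra.
  by rewrite divr1; ring.
rewrite max_l; last by lra.
have u0 : u != 0 by apply: contraTneq u1 => ->; rewrite expr0n/= -leNgt.
by rewrite addr0; field.
Qed.

Lemma continuous_ebump : continuous ebump.
Proof.
have csq : continuous (fun y : R => y ^+ 2).
  by solve_cont.
apply: contM; last by solve_cont.
apply: contM; first exact: cont_id.
apply: contV; first by solve_cont.
by move=> x; rewrite gt_eqF// lt_max ltr01.
Qed.

Lemma ebump_le u : `|ebump u| <= 2.
Proof.
rewrite /ebump normrM normrM normfV.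
have m1 : 1 <= Num.max 1 (u ^+ 2) by rewrite le_max lexx.
rewrite (ger0_norm (le_trans ler01 m1)).
have h1 : `|u| / Num.max 1 (u ^+ 2) <= 1.
  rewrite ler_pdivrMr ?(lt_le_trans _ m1)// mul1r le_max.
  rewrite -(real_normK (num_real u)).
  have [//|/ltW u1] := leP `|u| 1.
  by rewrite /= expr2 ler_peMl.
have h2 : `|1 + Num.max 0 (1 - u ^+ 2)| <= 2.
  rewrite ger0_norm ?addr_ge0 ?le_max ?lexx//.
  rewrite -[2]/(1 + 1)%R lerD2l ge_max ler01/=.
  by have := sqr_ge0 u; lra.
by rewrite -[2]mul1r ler_pM// mulr_ge0// invr_ge0 (le_trans ler01 m1).
Qed.

End bump.

Section half_branch.
Context {R : realType} (alpha : R) (alpha01 : 0 < alpha < 1).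
Implicit Types (x : R).
Ltac alra := move: (alpha01); lra.

(** The power (2 |x|)^alpha.  The left branch is x (1 + (2 x)^alpha) and has
    slope 1 + (1 + alpha) (2 x)^alpha. *)
Definition pw x : R := 2 `^ alpha * `|x| `^ alpha.

Lemma pw0 : pw 0 = 0.
Proof. by rewrite /pw normr0 powR0 ?mulr0// gt_eqF//; alra. Qed.

Lemma pw_ge0 x : 0 <= pw x.
Proof. by rewrite mulr_ge0// powR_ge0. Qed.

Lemma pw_gt0 x : 0 < x -> 0 < pw x.
Proof. by move=> x0; rewrite mulr_gt0// powR_gt0// normr_gt0 gt_eqF. Qed.

Lemma pw_half : pw 2^-1 = 1.
Proof.
rewrite /pw ger0_norm; last by alra.
by rewrite -powRM ?mulfV ?powR1 ?pnatr_eq0//; alra.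
Qed.

Lemma pw_le x y : 0 <= x <= y -> pw x <= pw y.
Proof.
move=> /andP[x0 xy]; rewrite ler_pM2l; last by rewrite powR_gt0//; alra.
apply: ge0_ler_powR; rewrite ?nnegrE//; first by alra.
by rewrite !ger0_norm ?(le_trans x0).
Qed.

Lemma pw_le1 x : 0 <= x <= 2^-1 -> pw x <= 1.
Proof. by move=> /pw_le; rewrite pw_half. Qed.

Lemma is_derive_pw x : 0 < x -> is_derive x 1 pw (alpha * (pw x / x)).
Proof.
move=> x0.
have d := is_derive1Mc (2 `^ alpha) (is_derive1_powR alpha x0).
have -> : alpha * (pw x / x) = 2 `^ alpha * (alpha * x `^ (alpha - 1)).
  rewrite /pw ger0_norm ?(ltW x0)// powRB; last by rewrite (gt_eqF x0) implybT.
  by rewrite powRr1 ?(ltW x0)//; ring.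
apply: (near_eq_is_derive _ d).
near=> y; rewrite /pw ger0_norm//.
  by apply: ltW; near: y; exact: lt_nbhsr.
Unshelve. all: by end_near. Qed.

Lemma continuous_powR_norm : continuous (fun x : R => `|x| `^ alpha).
Proof.
move=> x; have [->|x0] := eqVneq x 0.
  rewrite /continuous_at normr0 powR0; last by rewrite gt_eqF//; alra.
  apply/cvgr0Pnorm_le => e e0.
  have h : \forall y \near (0 : R), `|y| <= e `^ alpha^-1.
    by apply: nbhs0_le; rewrite powR_gt0.
  near=> y.
  rewrite ger0_norm ?powR_ge0//.
  have -> : e = (e `^ alpha^-1) `^ alpha.
    by rewrite -powRrM mulVf ?powRr1 ?(ltW e0)// gt_eqF//; alra.
  apply: ge0_ler_powR; rewrite ?nnegrE ?powR_ge0//; first by alra.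
  by near: y; exact: h.
have h : {for `|x|, continuous (fun y : R => y `^ alpha)}.
  apply: differentiable_continuous; apply/derivable1_diffP.
  by apply: derivable_powR; rewrite in_itv/= andbT normr_gt0.
apply: (@continuous_comp _ _ _ (fun y : R => `|y|) (fun y : R => y `^ alpha)) => //.
exact: norm_continuous.
Unshelve. all: by end_near. Qed.

Lemma continuous_pw : continuous pw.
Proof. by apply: contM; [exact: cont_cst|exact: continuous_powR_norm]. Qed.

Definition branch x : R := x * (1 + pw x).
Definition slope x : R := 1 + (1 + alpha) * pw x.

Lemma continuous_branch : continuous branch.
Proof.
by have cpw := continuous_pw; rewrite /branch; solve_cont.
Qed.

Lemma continuous_slope : continuous slope.
Proof. by have cpw := continuous_pw; rewrite /slope; solve_cont. Qed.

Lemma slope_ge1 x : 1 <= slope x.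
Proof. by rewrite /slope lerDl mulr_ge0 ?pw_ge0//; alra. Qed.

Lemma is_derive_branch x : 0 < x -> is_derive x 1 branch (slope x).
Proof.
move=> x0.
have := is_derive1M (is_derive1_id x) (is_derive1D (is_derive1_c 1 x) (is_derive_pw x0)).
have -> // : 1 * (1 + pw x) + x * (0 + alpha * (pw x / x)) = slope x.
by rewrite /slope; field; rewrite gt_eqF.
Qed.

Lemma intermittent_left x : 0 <= x < 2^-1 -> intermittent_fun alpha x = branch x.
Proof.
move=> /andP[x0 x2]; rewrite /intermittent_fun x2 /branch /pw ger0_norm//.
rewrite powRD ?powRr1//; first by ring.
by apply/implyP => /eqP; alra.
Qed.

Lemma intermittent_right x : 2^-1 <= x <= 1 ->
  intermittent_fun alpha x = 1 - branch (1 - x).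
Proof.
move=> /andP[x2 x1]; rewrite /intermittent_fun ltNge x2/= /branch /pw.
rewrite ger0_norm; last by alra.
rewrite powRD ?powRr1//; [by ring|by alra|].
by apply/implyP => /eqP; alra.
Qed.

(** The quantity x T''/T'^2, that is - x (1/T')'.  Unlike T''/T'^2 it is
    bounded, which is why the factor 1/x is kept apart. *)
Definition curv x : R :=
  (1 + alpha) * alpha * pw x * (slope x)^-1 * (slope x)^-1.

Lemma slope_gt0 x : 0 < slope x.
Proof. exact: lt_le_trans ltr01 (slope_ge1 x). Qed.

Lemma slope_neq0 x : slope x != 0.
Proof. by rewrite gt_eqF// slope_gt0. Qed.

Lemma slopeV_itv x : 0 < (slope x)^-1 <= 1.
Proof. by rewrite invr_gt0 slope_gt0 invf_le1 ?slope_gt0// slope_ge1. Qed.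

Lemma continuous_slopeV : continuous (fun x => (slope x)^-1).
Proof. by apply: contV; [exact: continuous_slope|exact: slope_neq0]. Qed.

Lemma continuous_curv : continuous curv.
Proof.
have cp := continuous_pw; have csV := continuous_slopeV.
by rewrite /curv; solve_cont.
Qed.

Lemma is_derive_slopeV x : 0 < x ->
  is_derive x 1 (fun y => (slope y)^-1) (- curv x / x).
Proof.
move=> x0.
have ds0 := is_derive1D (is_derive1_c 1 x)
  (is_derive1Mc (1 + alpha) (is_derive_pw x0)).
have := is_derive1V (slope_neq0 x) ds0.
have -> // : - (0 + (1 + alpha) * (alpha * (pw x / x))) / slope x ^+ 2 =
    - curv x / x.
by rewrite /curv; field; rewrite slope_neq0 gt_eqF.
Qed.

Lemma curv_ge0 x : 0 <= curv x.
Proof.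
have p0 := pw_ge0 x; have /andP[/ltW s0 _] := slopeV_itv x.
by rewrite /curv !mulr_ge0//; alra.
Qed.

Lemma curv_le2 x : 0 <= x <= 2^-1 -> curv x <= 2.
Proof.
move=> /pw_le1 p1; have p0 := pw_ge0 x; have /andP[/ltW s0 s1] := slopeV_itv x.
have h1 : (slope x)^-1 * (slope x)^-1 <= 1 by rewrite mulr_ile1.
have h2 : (1 + alpha) * alpha <= 2 by have := alpha01; nra.
have h3 : 0 <= (1 + alpha) * alpha by apply: mulr_ge0; alra.
have h4 : (1 + alpha) * alpha * pw x <= 2 by rewrite -[2]mulr1 ler_pM.
have h5 : 0 <= (1 + alpha) * alpha * pw x by rewrite mulr_ge0.
have := ler_pM h5 (mulr_ge0 s0 s0) h4 h1; rewrite mulr1.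
by rewrite /curv !mulrA.
Qed.

Lemma branch_ge x : 0 <= x -> x <= branch x.
Proof. by move=> x0; rewrite /branch ler_peMr// lerDl pw_ge0. Qed.

Definition gain : R := alpha / (2 * (2 + alpha)).

Lemma gain_gt0 : 0 < gain.
Proof. by rewrite /gain divr_gt0 ?mulr_gt0//; alra. Qed.

(** Convexity of the branch, made quantitative: T/T' falls below the identity
    by a multiple of x (2x)^alpha.  This loss is what the whole proof lives on. *)
Lemma slopeV_branch_le x : 0 <= x <= 2^-1 ->
  (slope x)^-1 * branch x <= x - 2 * gain * (x * pw x).
Proof.
move=> x01; have p1 := pw_le1 x01; have p0 := pw_ge0 x; have g0 := gain_gt0.
have x0 : 0 <= x by case/andP: x01.
rewrite mulrC ler_pdivrMr ?slope_gt0// /branch /slope.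
have c2 : 2 * gain * (2 + alpha) = alpha by rewrite /gain; field; alra.
have h : 2 * gain * (1 + (1 + alpha) * pw x) <= alpha.
  have c20 : 0 < 2 * gain by rewrite mulr_gt0.
  rewrite -[X in _ <= X]c2 ler_pM2l//.
  have : (1 + alpha) * pw x <= (1 + alpha) * 1 by rewrite ler_wpM2l//; alra.
  alra.
have xp : 0 <= x * pw x by rewrite mulr_ge0.
have := ler_wpM2l xp h; nra.
Qed.

End half_branch.

(** * Transferring a primitive across one branch *)

Lemma periodic_cap_le1 (R : realType) (r : R) (psi : R -> R) :
  r <= 1 -> periodic1 psi -> (forall y, `|psi y| <= Num.max `|y| r) ->
  forall y, `|psi y| <= 1.
Proof.
move=> r1 ppsi psi_le y; rewrite -(periodic1_frac y ppsi).
have /andP[f0 f1] := frac_part_itv y.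
by rewrite (le_trans (psi_le _))// ge_max ger0_norm// (ltW f1).
Qed.

Lemma le_of_ler0_derive (R : realType) (f df : R -> R) (a b : R) : a <= b ->
  {in `[a, b], continuous f} ->
  (forall x : R, a < x < b -> is_derive x 1 f (df x)) ->
  (forall x, a < x < b -> df x <= 0) -> f b <= f a.
Proof.
rewrite le_eqVlt => /orP[/eqP->//|ab] cf df' df0.
have fd (x : R) : x \in `]a, b[ -> is_derive x 1 f (df x).
  by rewrite in_itv/= => /df'.
have [|z zab fE] := MVT ab fd.
- by apply: continuous_in_subspaceT => x; rewrite inE/= => /cf.
- rewrite -subr_le0 fE.
  by rewrite mulr_le0_ge0 ?df0 ?subr_ge0 ?(ltW ab)//; rewrite in_itv/= in zab.
Qed.

Section half_step.
Context {R : realType} (alpha r : R).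
Context (alpha01 : 0 < alpha < 1) (r01 : 0 < r <= 4^-1).
Context (psi phi : R -> R) (t : R) (C1psi : C1circle psi phi).
Implicit Types x : R.

Local Notation p := (pw alpha).
Local Notation k := (branch alpha).
Local Notation s := (slope alpha).
Local Notation r1 := (r / 4).

Let cphik : continuous (fun x => phi (k x + t)).
Proof.
have [_ cphi _ _] := C1psi.
apply: (@cont_comp _ phi (fun x => k x + t)) => //.
by have ck := continuous_branch alpha01; solve_cont.
Qed.

Let cpsik : continuous (fun x => psi (k x + t)).
Proof.
have [_ _ _ dpsi] := C1psi.
apply: (@cont_comp _ psi (fun x => k x + t)) => //.
  by move=> x; exact: is_derive_continuous (dpsi x).
by have ck := continuous_branch alpha01; solve_cont.
Qed.

(* The primitive of phi o T_t vanishing at 0. *)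
Let P := projT1 (cid (primitive cphik)).

Let P0 : P 0 = 0.
Proof. by rewrite /P; case: cid => /= F []. Qed.

Let dP x : is_derive x 1 P (phi (k x + t)).
Proof. by rewrite /P; case: cid => /= F []. Qed.

Let cP : continuous P.
Proof. by move=> x; exact: is_derive_continuous (dP x). Qed.

(** Near 0 the primitive P + psi t of phi o T_t is preferred to the quotient
    psi o T_t / T'; this is the difference of the two. *)
Definition core_defect x := psi (k x + t) * (s x)^-1 - psi t - P x.
Definition core_cutoff x := bump (r1^-1 * x).
Definition mid_cutoff x : R := bump (4 * x - 2).

(** The quotient psi o T_t / T' with two corrections.  Towards 0, on the
    scale r/4, it is deformed into the primitive psi t + P, because T'' is unbounded
    there.  Around 1/2, psi t is subtracted from psi o T_t, so that the value at 1/2 is 0 and matches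
    the one coming from the other branch. *)
Definition half_transfer x :=
  (s x)^-1 * (psi (k x + t) - psi t * mid_cutoff x) -
  core_cutoff x * core_defect x.

Let dcore x := dbump (r1^-1 * x) * r1^-1.
Let dmid x : R := dbump (4 * x - 2) * 4.

(** What separates the derivative of [half_transfer] from phi o T_t.  Each
    factor 1/x coming from T'' is absorbed: by [ebump] in the first term, and in
    the last one by Num.max, harmless where the middle cutoff lives. *)
Definition half_error x :=
  - (curv alpha x * (ebump (r1^-1 * x) * r1^-1)) * psi (k x + t)
  - dcore x * core_defect x
  + (curv alpha x * (mid_cutoff x / Num.max x 4^-1) - (s x)^-1 * dmid x)
    * psi t.

Let r1_gt0 : 0 < r1.
Proof. by move: r01; lra. Qed.

Let core_cutoff_far x : r1 <= x -> core_cutoff x = 0 /\ dcore x = 0.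
Proof.
move=> x0; have h : 1 <= `|r1^-1 * x|.
  rewrite ger0_norm ?mulr_ge0 ?invr_ge0 ?(ltW r1_gt0) ?(le_trans (ltW r1_gt0))//.
  by rewrite mulrC ler_pdivlMr// mul1r.
by rewrite /core_cutoff /dcore; have [-> ->] := bump_ge1 h; rewrite mul0r.
Qed.

Let mid_cutoff_small x : x <= 4^-1 -> mid_cutoff x = 0 /\ dmid x = 0.
Proof.
move=> x0; have h : 1 <= `|4 * x - 2| by rewrite ler0_norm; lra.
by rewrite /mid_cutoff /dmid; have [-> ->] := bump_ge1 h; rewrite mul0r.
Qed.

Let k0 : k 0 = 0. Proof. by rewrite /branch mul0r. Qed.

Let s_at0 : s 0 = 1. Proof. by rewrite /slope pw0// mulr0 addr0. Qed.

Let core_defect0 : core_defect 0 = 0.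
Proof. by rewrite /core_defect k0 P0 s_at0 add0r invr1 mulr1 subrr subr0. Qed.

Let continuous_core_defect : continuous core_defect.
Proof.
have csV := continuous_slopeV alpha01.
by rewrite /core_defect; solve_cont.
Qed.

Let cmid : continuous mid_cutoff.
Proof.
apply: (@cont_comp _ (@bump R) (fun x => 4 * x - 2)); first exact: continuous_bump.
by solve_cont.
Qed.

Let ccore : continuous core_cutoff.
Proof.
apply: (@cont_comp _ (@bump R) (fun x => r1^-1 * x)); first exact: continuous_bump.
by solve_cont.
Qed.

Lemma continuous_half_transfer : continuous half_transfer.
Proof.
have csV := continuous_slopeV alpha01; have cQ := continuous_core_defect.
by rewrite /half_transfer; solve_cont.
Qed.

Lemma continuous_half_error : continuous half_error.
Proof.
have csV := continuous_slopeV alpha01; have cQ := continuous_core_defect.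
have cc := continuous_curv alpha01.
have cV : continuous (fun x : R => (Num.max x 4^-1)^-1).
  apply: contV; first by solve_cont.
  by move=> x; rewrite gt_eqF// lt_max invr_gt0 ltr0n orbT.
have c1 : continuous (fun x => ebump (r1^-1 * x)).
  apply: (@cont_comp _ (@ebump R) (fun x => r1^-1 * x)).
    exact: continuous_ebump.
  by solve_cont.
have c2 : continuous (fun x => dbump (r1^-1 * x)).
  apply: (@cont_comp _ (@dbump R) (fun x => r1^-1 * x)).
    exact: continuous_dbump.
  by solve_cont.
have c3 : continuous (fun x : R => dbump (4 * x - 2)).
  apply: (@cont_comp _ (@dbump R) (fun x => 4 * x - 2)).
    exact: continuous_dbump.
  by solve_cont.
have c4 : continuous dcore by rewrite /dcore; solve_cont.
have c5 : continuous dmid by rewrite /dmid; solve_cont.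
by rewrite /half_error; solve_cont.
Qed.

Let dpsik x : 0 < x ->
  is_derive x 1 (fun y => psi (k y + t)) (phi (k x + t) * s x).
Proof.
have [_ _ _ dpsi] := C1psi => x0.
have := @is_derive1o _ psi (fun y => k y + t) _ _ _ (dpsi _)
  (is_derive1D (is_derive_branch alpha x0) (is_derive1_c t x)).
by rewrite addr0.
Qed.

Let dcore_defect x : 0 < x ->
  is_derive x 1 core_defect (- curv alpha x / x * psi (k x + t)).
Proof.
move=> x0.
have := is_derive1B (is_derive1B (is_derive1M (dpsik x0)
  (is_derive_slopeV alpha01 x0)) (is_derive1_c (psi t) x)) (dP x).
have -> // : phi (k x + t) * s x * (s x)^-1 +
    psi (k x + t) * (- curv alpha x / x) - 0 - phi (k x + t) =
    - curv alpha x / x * psi (k x + t).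
by rewrite mulfK ?slope_neq0//; ring.
Qed.

Lemma is_derive_half_transfer x : 0 < x ->
  is_derive x 1 half_transfer (phi (k x + t) + half_error x).
Proof.
move=> x0; have xn0 : x != 0 by rewrite gt_eqF.
have r1n0 : r1 != 0 by rewrite gt_eqF.
have dchiE : is_derive x 1 core_cutoff (dcore x).
  have := @is_derive1o _ bump (fun y => r1^-1 * y) _ _ _ (is_derive_bump _)
    (is_derive1Mc r1^-1 (is_derive1_id x)).
  by rewrite mulr1.
have dzetaE : is_derive x 1 mid_cutoff (dmid x).
  exact: (@is_derive1o _ bump (fun y => 4 * y - 2) _ _ _ (is_derive_bump _)
    (is_derive1_affine 4 (- 2) x)).
(* The middle cutoff vanishes on [0,1/4]. *)
have zetaV : mid_cutoff x / Num.max x 4^-1 = mid_cutoff x / x.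
  have [x4|x4] := leP x 4^-1; last by [].
  by have [-> _] := mid_cutoff_small x4; rewrite !mul0r.
have := is_derive1B (is_derive1M (is_derive_slopeV alpha01 x0)
    (is_derive1B (dpsik x0) (is_derive1Mc (psi t) dzetaE)))
  (is_derive1M dchiE (dcore_defect x0)).
suff <- : - curv alpha x / x * (psi (k x + t) - psi t * mid_cutoff x) +
   (s x)^-1 * (phi (k x + t) * s x - psi t * dmid x) -
   (dcore x * core_defect x +
    core_cutoff x * (- curv alpha x / x * psi (k x + t))) =
   phi (k x + t) + half_error x by [].
rewrite /half_error zetaV.
have -> : core_cutoff x = 1 - r1^-1 * x * ebump (r1^-1 * x).
  by rewrite -ebumpE /core_cutoff; ring.
move: (ebump _) (core_defect x) (curv alpha x) (slope_neq0 alpha01 x).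
move: (s x) (dcore x) (dmid x) (mid_cutoff x) (phi _) (psi _).
move=> sx dc dm mc ph ps ee q gam sn0; field.
by move: r1n0; rewrite mulf_eq0 negb_or => /andP[-> _]; rewrite sn0 xn0.
Qed.

Let psi1t : psi (1 + t) = psi t.
Proof. by have [ppsi _ _ _] := C1psi; rewrite addrC ppsi. Qed.

(** These values depend on [psi] and [t] only through [psi t], which is the
    same for the reflected data x |-> psi (- x) and - t: the two halves match. *)
Lemma half_transfer_ends : half_transfer 0 = psi t /\ half_transfer 2^-1 = 0.
Proof.
have [z0 _] := @mid_cutoff_small 0 (ltac:(lra)).
have r1h : r1 <= 2^-1 by move: r01; lra.
have [chi1 _] := core_cutoff_far r1h.
split.
  by rewrite /half_transfer s_at0 k0 add0r z0 core_defect0 invr1; ring.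
rewrite /half_transfer chi1 (_ : mid_cutoff 2^-1 = 1).
  rewrite (_ : k 2^-1 = 1) ?psi1t; first by ring.
  by rewrite /branch pw_half//; field.
by rewrite /mid_cutoff (_ : 4 * 2^-1 - 2 = 0) ?(proj1 bump0)//; field.
Qed.

Lemma half_error_ends : half_error 0 = 0 /\ half_error 2^-1 = 0.
Proof.
have [_ z0] := @mid_cutoff_small 0 (ltac:(lra)).
have r1h : r1 <= 2^-1 by move: r01; lra.
have [chi1 dchi1] := core_cutoff_far r1h.
split.
  have c0 : curv alpha 0 = 0 by rewrite /curv pw0// mulr0 !mul0r.
  rewrite /half_error z0 c0 core_defect0.
  by rewrite !(mul0r, mulr0, oppr0, subr0, addr0).
have e0 : 4 * 2^-1 - 2 = 0 :> R by field.
have [b0 db0] := @bump0 R.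
rewrite /half_error dchi1 /dmid /mid_cutoff e0 b0 db0.
rewrite (_ : k 2^-1 = 1) ?psi1t; last by rewrite /branch pw_half//; field.
rewrite max_l; last by lra.
have := ebumpE (r1^-1 * 2^-1); rewrite -[bump _]/(core_cutoff 2^-1) chi1 subr0.
move=> e1; have -> : ebump (r1^-1 * 2^-1) * r1^-1 = 2 by move: e1; lra.
by rewrite invrK; ring.
Qed.

Context (psi_le : forall y, `|psi y| <= Num.max `|y| r).

Let psi_le1 y : `|psi y| <= 1.
Proof.
have [ppsi _ _ _] := C1psi.
by apply: (@periodic_cap_le1 _ r) => //; move: r01; lra.
Qed.

Context (e : R) (e0 : 0 <= e) (er : e <= r / 2) (te : `|t| <= e).

Let psik_le x : 0 <= x -> `|psi (k x + t)| <= Num.max (k x + e) r.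
Proof.
move=> x0; apply: (le_trans (psi_le _)).
rewrite ge_max le_max le_max lexx orbT andbT.
apply/orP; left; apply: (le_trans (ler_normD _ _)).
by rewrite (ger0_norm (le_trans x0 (branch_ge _ x0))) lerD2l.
Qed.

Let psik_core x : 0 <= x <= r1 -> `|psi (k x + t)| <= r.
Proof.
move=> x01; have x0 : 0 <= x by case/andP: x01.
apply: (le_trans (psik_le x0)); rewrite ge_max lexx andbT.
have p1 := @pw_le1 _ _ alpha01 x (ltac:(move: r01 x01; lra)).
have := pw_ge0 alpha x; move: x01 er; rewrite /branch; nra.
Qed.

(** The derivative of the defect is - (T''/T'^2) psi o T_t, and psi o T_t is
    at most r on the core; the integral of r T''/T'^2 is r (1 - 1/T'). *)
Lemma core_defect_le x : 0 <= x <= r1 ->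
  `|core_defect x| <= r * (1 - (s x)^-1).
Proof.
move=> x01; have x0 : 0 <= x by case/andP: x01.
have inner y : 0 < y < x -> `|psi (k y + t)| <= r.
  by move=> ?; apply: psik_core; lra.
have Gy y : 0 < y < x -> 0 <= curv alpha y / y.
  by move=> y0; rewrite divr_ge0 ?curv_ge0//; lra.
have csV := continuous_slopeV alpha01; have cQ := continuous_core_defect.
have dV y : 0 < y < x ->
    is_derive y 1 (fun y => r * (s y)^-1) (r * (- curv alpha y / y)).
  by move=> /andP[y0 _]; apply: is_derive1Mc; exact: is_derive_slopeV.
have dQ y : 0 < y < x ->
    is_derive y 1 core_defect (- curv alpha y / y * psi (k y + t)).
  by move=> /andP[y0 _]; exact: dcore_defect.
have sV0 : (s 0)^-1 = 1 by rewrite s_at0 invr1.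
rewrite ler_norml; apply/andP; split.
- have h := le_of_ler0_derive x0 _ (fun y yx => is_derive1B (dV y yx) (dQ y yx)).
  suff : r * (s x)^-1 - core_defect x <= r * (s 0)^-1 - core_defect 0.
    by rewrite sV0 core_defect0; lra.
  apply: h; first by move=> y _; apply: contB => //; solve_cont.
  move=> y yx; have := inner _ yx; have := Gy _ yx.
  by rewrite ler_norml mulNr; nra.
- have h := le_of_ler0_derive x0 _ (fun y yx => is_derive1D (dV y yx) (dQ y yx)).
  suff : r * (s x)^-1 + core_defect x <= r * (s 0)^-1 + core_defect 0.
    by rewrite sV0 core_defect0; lra.
  apply: h; first by move=> y _; apply: contD => //; solve_cont.
  move=> y yx; have := inner _ yx; have := Gy _ yx.
  by rewrite ler_norml mulNr; nra.
Qed.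

Lemma half_error_le x : 0 <= x <= 2^-1 -> `|half_error x| <= 8 / r1 + 24.
Proof.
move=> x01; have x0 : 0 <= x by case/andP: x01.
have rV0 : 0 <= r1^-1 by rewrite invr_ge0 ltW.
have G0 := curv_ge0 alpha01 x; have G2 := curv_le2 alpha01 x01.
have /andP[sV0 sV1] := slopeV_itv alpha01 x.
have -> : 8 / r1 + 24 =
    2 * (2 * r1^-1) * 1 + (4 * r1^-1) * 1 + (2 * 4 + 1 * 16) * 1 by ring.
rewrite /half_error; apply: (le_trans (ler_normD _ _)); apply: lerD.
  apply: (le_trans (ler_normB _ _)); apply: lerD.
    rewrite normrM; apply: ler_pM => //.
    rewrite normrN normrM ger0_norm//; apply: ler_pM => //.
    by rewrite normrM (ger0_norm rV0) ler_pM// ebump_le.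
  have [xr|xr] := leP x r1.
    rewrite normrM; apply: ler_pM => //.
      by rewrite /dcore normrM (ger0_norm rV0) ler_pM// dbump_le.
    have xc : 0 <= x <= r1 by rewrite x0.
    by apply: (le_trans (core_defect_le xc)); rewrite mulr_ile1//; move: r01; lra.
  have [_ ->] := core_cutoff_far (ltW xr); rewrite mul0r normr0.
  by rewrite mulr1 mulr_ge0.
rewrite normrM; apply: ler_pM => //.
apply: (le_trans (ler_normB _ _)); apply: lerD.
  rewrite normrM (ger0_norm G0); apply: ler_pM => //.
  have m4 : 0 < Num.max x 4^-1 by rewrite lt_max invr_gt0 ltr0n orbT.
  have /andP[z0 z1] := bump_itv (4 * x - 2).
  rewrite normrM normfV (gtr0_norm m4) ger0_norm// ler_pdivrMr//.
  by apply: (le_trans z1); rewrite -ler_pdivrMl// mulr1 le_max lexx orbT.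
rewrite normrM (ger0_norm (ltW sV0)); apply: ler_pM => //; first exact: ltW.
rewrite /dmid normrM (ger0_norm (_ : 0 <= 4))//.
by rewrite (_ : 16 = 4 * 4) ?ler_pM ?dbump_le//; ring.
Qed.

(* Noise small against the loss at the edge of the core, and r + e small
   against the loss on [1/4, 1/2], where the correction at 1/2 is active. *)
Context (eloss : e <= gain alpha * (r1 * p r1)).
Context (reloss : r + e <= gain alpha * (4^-1 * p 4^-1)).

Let loss_le x y : 0 <= y <= x ->
  gain alpha * (y * p y) <= gain alpha * (x * p x).
Proof.
move=> /[dup] yx /andP[y0 yx'].
by rewrite ler_pM2l ?gain_gt0// ler_pM ?pw_ge0// pw_le.
Qed.

Let half_transfer_far x : r1 < x <= 2^-1 ->
  `|half_transfer x| <= Num.max (x - gain alpha * (x * p x)) ((s x)^-1 * r).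
Proof.
move=> /andP[xr x2]; have x0 : 0 <= x by rewrite (le_trans (ltW r1_gt0))// ltW.
have x01 : 0 <= x <= 2^-1 by rewrite x0.
have /andP[sV0 sV1] := slopeV_itv alpha01 x.
have gk := slopeV_branch_le alpha01 x01.
rewrite /half_transfer (proj1 (core_cutoff_far (ltW xr))) mul0r subr0.
rewrite normrM (gtr0_norm sV0).
have [x4|x4] := leP x 4^-1.
  rewrite (proj1 (mid_cutoff_small x4)) mulr0 subr0.
  have : (s x)^-1 * `|psi (k x + t)| <= (s x)^-1 * Num.max (k x + e) r.
    by rewrite ler_pM2l// psik_le.
  move=> /le_trans; apply.
  have [_|_] := leP (k x + e) r; first by rewrite le_max lexx orbT.
  rewrite mulrDr le_max; apply/orP; left.
  have h1 : (s x)^-1 * e <= e by rewrite ler_piMl.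
  have h2 : e <= gain alpha * (x * p x).
    by apply: (le_trans eloss); apply: loss_le; rewrite (ltW xr) (ltW r1_gt0).
  by lra.
rewrite le_max; apply/orP; left.
have h3 : `|psi (k x + t) - psi t * mid_cutoff x| <= k x + (r + e).
  apply: (@le_trans _ _ (k x + e + r)); last by lra.
  apply: (le_trans (ler_normB _ _)); apply: lerD.
    apply: (le_trans (psik_le x0)); rewrite ge_max lexx/=.
    by have := branch_ge alpha x0; move: r01 e0; lra.
  rewrite normrM -[X in _ <= X]mulr1; apply: ler_pM => //.
    have := @psik_core 0; rewrite k0 add0r; apply.
    by rewrite lexx ltW.
  have /andP[z0 z1] := bump_itv (4 * x - 2).
  by rewrite ger0_norm.
have h4 : (s x)^-1 * `|psi (k x + t) - psi t * mid_cutoff x| <=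
          (s x)^-1 * (k x + (r + e)) by rewrite ler_pM2l.
apply: (le_trans h4); rewrite mulrDr.
have h1 : (s x)^-1 * (r + e) <= r + e.
  by rewrite ler_piMl// addr_ge0//; case/andP: r01 => /ltW.
have h2 : r + e <= gain alpha * (x * p x).
  by apply: (le_trans reloss); apply: loss_le; rewrite (ltW x4) invr_ge0 ler0n.
by lra.
Qed.

(** On the core, the quotient contributes r/T' and the defect r (1 - 1/T'),
    in all r.  Off the core, the loss in [slopeV_branch_le] pays for the noise and
    for the correction at 1/2. *)
Lemma half_transfer_le x : 0 <= x <= 2^-1 -> `|half_transfer x| <= Num.max x r.
Proof.
move=> x01; have x0 : 0 <= x by case/andP: x01.
have /andP[sV0 sV1] := slopeV_itv alpha01 x.
have [xr|xr] := leP x r1.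
  rewrite /half_transfer (proj1 (@mid_cutoff_small x _)); last first.
    by move: r01 xr; lra.
  have xc : 0 <= x <= r1 by rewrite x0.
  rewrite mulr0 subr0; apply: (le_trans (ler_normB _ _)).
  rewrite (normrM (s x)^-1) (normrM (core_cutoff x)) (gtr0_norm sV0) le_max.
  apply/orP; right.
  have h1 : (s x)^-1 * `|psi (k x + t)| <= (s x)^-1 * r.
    by rewrite ler_pM2l// psik_core.
  have h2 : `|core_cutoff x| * `|core_defect x| <= 1 * (r * (1 - (s x)^-1)).
    have /andP[z0 z1] := bump_itv (r1^-1 * x).
    by rewrite ler_pM// ?core_defect_le// ger0_norm.
  by lra.
have xr2 : r1 < x <= 2^-1 by rewrite xr; case/andP: x01.
apply: (le_trans (half_transfer_far xr2)).
rewrite ge_max !le_max; apply/andP; split.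
  have : 0 <= gain alpha * (x * p x).
    exact: mulr_ge0 (ltW (gain_gt0 alpha01)) (mulr_ge0 x0 (pw_ge0 _ _)).
  by move=> ?; apply/orP; left; lra.
by apply/orP; right; rewrite ler_piMl//; case/andP: r01 => /ltW.
Qed.

Lemma half_transfer_loss x : r <= x <= 2^-1 ->
  `|half_transfer x| <= x - gain alpha * (x * p x).
Proof.
move=> /andP[rx x2]; have [r0 _] := andP r01.
have x0 : 0 <= x by rewrite (le_trans _ rx)// ltW.
have x01 : 0 <= x <= 2^-1 by rewrite x0.
have /andP[sV0 sV1] := slopeV_itv alpha01 x.
have xr2 : r1 < x <= 2^-1 by rewrite x2 andbT; lra.
apply: (le_trans (half_transfer_far xr2)); rewrite ge_max lexx/=.
have gk := slopeV_branch_le alpha01 x01.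
apply: (@le_trans _ _ ((s x)^-1 * k x)).
  by rewrite ler_pM2l// (le_trans rx)// branch_ge.
have : 0 <= gain alpha * (x * p x).
  exact: mulr_ge0 (ltW (gain_gt0 alpha01)) (mulr_ge0 x0 (pw_ge0 _ _)).
by move: gk; lra.
Qed.

End half_step.

(** * One step of the transfer on the circle *)

(** A periodic bound by the distance to the nearest integer is a bound by
    |y|, which is no smaller. *)
Lemma periodic_cap (R : realType) (r : R) (psi : R -> R) : periodic1 psi ->
  (forall x : R, 0 <= x <= 2^-1 -> `|psi x| <= Num.max x r) ->
  (forall x : R, 2^-1 <= x <= 1 -> `|psi x| <= Num.max (1 - x) r) ->
  forall y, `|psi y| <= Num.max `|y| r.
Proof.
move=> ppsi h1 h2 y; rewrite -(periodic1_frac y ppsi).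
have /andP[f0 f1] := frac_part_itv y.
suff [[f12 fy]|[f12 fy]] : frac_part y <= 2^-1 /\ frac_part y <= `|y| \/
    2^-1 <= frac_part y /\ 1 - frac_part y <= `|y|.
- have x01 : 0 <= frac_part y <= 2^-1 by rewrite f0.
  by apply: (le_trans (h1 _ x01)); rewrite ge_max !le_max fy lexx orbT.
- have x01 : 2^-1 <= frac_part y <= 1 by rewrite f12 ltW.
  by apply: (le_trans (h2 _ x01)); rewrite ge_max !le_max fy lexx orbT.
have yE : y = frac_part y + (Num.floor y)%:~R by rewrite /frac_part subrK.
have [y0|y0] := leP 0 y.
  have fy : frac_part y <= y by rewrite /frac_part lerBlDr lerDl ler0z floor_ge0.
  rewrite ger0_norm//; have [?|?] := leP (frac_part y) 2^-1; first by left.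
  by right; split; lra.
have fly : (Num.floor y)%:~R <= -1 :> R.
  by rewrite -[-1]/((-1)%:~R) ler_int -ltzD1 addNr floor_lt0.
have fy : 1 - frac_part y <= - y by lra.
rewrite ltr0_norm//; have [?|/ltW ?] := leP (frac_part y) 2^-1; last by right.
by left; split=> //; lra.
Qed.

Lemma C1circle_opp (R : realType) (psi phi : R -> R) : C1circle psi phi ->
  C1circle (fun x => psi (- x)) (fun x => - phi (- x)).
Proof.
move=> [ppsi cphi pphi dpsi].
have cN : continuous (fun x : R => - x) by solve_cont.
split.
- by move=> x; rewrite -(ppsi (- (x + 1))); congr psi; ring.
- by apply: contN; exact: (cont_comp cphi cN).
- by move=> x; rewrite -(pphi (- (x + 1))); congr (- phi _); ring.
- move=> x.
  have dN : is_derive x 1 (fun y : R => - y) (-1).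
    exact: is_deriveN.
  have := @is_derive1o _ psi (fun y => - y) _ _ _ (dpsi (- x)) dN.
  by rewrite mulrN1.
Qed.

Lemma C1circleD (R : realType) (psi phi psi' phi' : R -> R) :
  C1circle psi phi -> C1circle psi' phi' ->
  C1circle (fun x => psi x + psi' x) (fun x => phi x + phi' x).
Proof.
move=> [ppsi cphi pphi dpsi] [ppsi' cphi' pphi' dpsi']; split.
- by move=> x; rewrite ppsi ppsi'.
- exact: contD.
- by move=> x; rewrite pphi pphi'.
- by move=> x; exact: is_derive1D.
Qed.

Definition step_error (R : realType) (r : R) : R := 8 / (r / 4) + 24.

(** The noise level e is small against the scale r below which nothing is
    gained, and r itself is small against the loss on [1/4, 1/2]. *)
Definition small_noise (R : realType) (alpha r e : R) :=
  [/\ 0 <= e, e <= r / 2,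
      e <= gain alpha * (r / 4 * pw alpha (r / 4)) &
      r + e <= gain alpha * (4^-1 * pw alpha 4^-1)].

(** The right half of the circle is the left half for the reflected data
    x |-> psi (- x) and - t, because T commutes with x |-> 1 - x.  The summand
    psi0 fits because on its support the transferred function is below x by at
    least the bound imposed on psi0. *)
Lemma transfer_step (R : realType) (alpha r e delta : R) :
  0 < alpha < 1 -> 0 < r <= 4^-1 -> r <= delta -> small_noise alpha r e ->
  forall psi0 phi0 : R -> R, C1circle psi0 phi0 ->
  (forall x : R, 0 <= x <= 1 ->
     `|psi0 x| <= gain alpha * (delta * pw alpha delta)) ->
  (forall x : R, 0 <= x <= 1 -> x < delta \/ 1 - delta < x -> psi0 x = 0) ->
  forall (psi phi : R -> R) (t : R), C1circle psi phi ->
  (forall y, `|psi y| <= Num.max `|y| r) -> `|t| <= e ->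
  exists psi' phi' : R -> R, [/\ C1circle psi' phi',
    forall y, `|psi' y| <= Num.max `|y| r &
    forall x : R, 0 <= x < 1 ->
      `|phi' x - (phi0 x + phi (intermittent_fun alpha x + t))| <=
        step_error r].
Proof.
move=> alpha01 r01 rdelta [e0 er eloss reloss] psi0 phi0 C0 psi0_le psi0_supp.
move=> psi phi t C1 psi_le te.
have C1N := C1circle_opp C1.
have psiN_le y : `|(fun x => psi (- x)) y| <= Num.max `|y| r.
  by rewrite -[`|y|]normrN; exact: psi_le.
have teN : `|- t| <= e by rewrite normrN.
pose a1 := half_transfer r alpha01 t C1; pose E1 := half_error r alpha01 t C1.
pose a2 := half_transfer r alpha01 (- t) C1N.
pose E2 := half_error r alpha01 (- t) C1N.
pose d1 x := phi (branch alpha x + t) + E1 x.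
pose d2 x := - phi (- (branch alpha x - t)) + E2 x.
have [ppsi cphi pphi dpsi] := C1.
have cb := continuous_branch alpha01.
have cE1 : continuous E1 by exact: continuous_half_error.
have cE2 : continuous E2 by exact: continuous_half_error.
have cd1 : continuous d1.
  apply: contD => //; apply: (@cont_comp _ phi (fun x => branch alpha x + t)) => //.
  by solve_cont.
have cd2 : continuous d2.
  apply: contD => //; apply: contN.
  apply: (@cont_comp _ phi (fun x => - (branch alpha x - t))) => //.
  by solve_cont.
have [a10 a1h] := half_transfer_ends alpha01 r01 t C1.
have [a20 a2h] := half_transfer_ends alpha01 r01 (- t) C1N.
have [E10 E1h] := half_error_ends alpha01 r01 t C1.
have [E20 E2h] := half_error_ends alpha01 r01 (- t) C1N.
have b0 : branch alpha 0 = 0 by rewrite /branch mul0r.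
have bh : branch alpha 2^-1 = 1 by rewrite /branch pw_half//; field.
have ca1 : continuous a1 by exact: continuous_half_transfer.
have ca2 : continuous a2 by exact: continuous_half_transfer.
have da1 (x : R) : 0 < x < 2^-1 -> is_derive x 1 a1 (d1 x).
  by move=> /andP[x0 _]; exact: is_derive_half_transfer.
have da2 (x : R) : 0 < x < 2^-1 -> is_derive x 1 a2 (d2 x).
  by move=> /andP[x0 _]; exact: is_derive_half_transfer.
have ea0 : a1 0 = a2 0 by rewrite /a1 /a2 a10 a20 opprK.
have eah : a1 2^-1 = a2 2^-1 by rewrite /a1 /a2 a1h a2h.
have ed0 : d1 0 = - d2 0.
  by rewrite /d1 /d2 /E1 /E2 E10 E20 b0 !addr0 opprK sub0r opprK add0r.
have edh : d1 2^-1 = - d2 2^-1.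
  rewrite /d1 /d2 /E1 /E2 E1h E2h bh !addr0 opprK -[in RHS]pphi.
  by rewrite -[in RHS]pphi; congr phi; ring.
have [psi1 [phi1 [C1' h1 h2]]] :=
  C1circle_glue ca1 ca2 cd1 cd2 da1 da2 ea0 eah ed0 edh.
exists (fun x => psi0 x + psi1 x), (fun x => phi0 x + phi1 x).
have lossle x : delta <= x -> gain alpha * (delta * pw alpha delta) <=
    gain alpha * (x * pw alpha x).
  move=> dx; have d0 : 0 <= delta by rewrite (le_trans _ rdelta)//; lra.
  by rewrite ler_pM2l ?gain_gt0// ler_pM ?pw_ge0// pw_le// d0.
have comb (y x : R) : 0 <= y <= 1 -> 0 <= x <= 2^-1 -> (psi0 y = 0 \/ delta <= x) ->
    `|psi1 y| <= Num.max x r ->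
    (r <= x -> `|psi1 y| <= x - gain alpha * (x * pw alpha x)) ->
    `|psi0 y + psi1 y| <= Num.max x r.
  move=> y01 x01 [->|dx] le1 le2; first by rewrite add0r.
  apply: (le_trans (ler_normD _ _)); rewrite le_max; apply/orP; left.
  by have := le2 (le_trans rdelta dx); have := psi0_le _ y01; have := lossle _ dx; lra.
split.
- exact: C1circleD.
- apply: periodic_cap.
  + by have [pp _ _ _] := C1circleD C0 C1'.
  + move=> x x01; have [hx _] := h1 _ x01; apply: comb => //.
    * by case/andP: x01 => ? ?; lra.
    * have [xd|] := ltP x delta; last by right.
      by left; apply: psi0_supp; [lra|left].
    * rewrite hx; exact: (half_transfer_le alpha01 r01 C1 psi_le e0 er te eloss reloss x01).
    * move=> rx; rewrite hx.
      apply: (half_transfer_loss alpha01 r01 C1 psi_le e0 er te eloss reloss).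
      by rewrite rx; case/andP: x01.
  + move=> x x01; have [hx _] := h2 _ x01.
    have x01' : 0 <= 1 - x <= 2^-1 by lra.
    apply: comb => //.
    * by case/andP: x01 => ? ?; lra.
    * have [xd|] := ltP (1 - x) delta; last by right.
      by left; apply: psi0_supp; [lra|right; lra].
    * rewrite hx; exact: (half_transfer_le alpha01 r01 C1N psiN_le e0 er teN eloss reloss x01').
    * move=> rx; rewrite hx.
      apply: (half_transfer_loss alpha01 r01 C1N psiN_le e0 er teN eloss reloss).
      by rewrite rx; case/andP: x01'.
- move=> x /andP[x0 x1]; rewrite opprD addrACA subrr add0r.
  have [xh|xh] := ltP x 2^-1.
    have x01 : 0 <= x <= 2^-1 by rewrite x0 ltW.
    rewrite intermittent_left ?x0// (proj2 (h1 _ x01)) /d1 addrAC subrr add0r.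
    exact: (half_error_le alpha01 r01 C1 psi_le er te x01).
  have x01 : 2^-1 <= x <= 1 by rewrite xh ltW.
  have x01' : 0 <= 1 - x <= 2^-1 by lra.
  rewrite intermittent_right// (proj2 (h2 _ x01)) /d2.
  have -> : phi (- (branch alpha (1 - x) - t)) = phi (1 - branch alpha (1 - x) + t).
    by rewrite -pphi; congr phi; ring.
  rewrite opprD opprK addrAC subrr add0r normrN.
  exact: (half_error_le alpha01 r01 C1N psiN_le er teN x01').
Qed.

(** * The circle and its coordinate *)

Section circle_basics.
Context {R : realType}.
Implicit Types (x y : R) (z : circle R).

Lemma circle_coordE z : circle_coord z = frac_part (repr z).
Proof. by []. Qed.

Lemma circle_projDz x (n : int) : circle_proj (x + n%:~R) = circle_proj x.
Proof.
rewrite /circle_proj; apply/eqmodP.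
change (x + n%:~R - x \is a Num.int).
by rewrite addrAC subrr add0r intr_int.
Qed.

Lemma circle_proj_frac x : circle_proj (frac_part x) = circle_proj x.
Proof. by rewrite /frac_part -mulrNz circle_projDz. Qed.

Lemma circle_coordK : cancel (@circle_coord R) (@circle_proj R).
Proof. by move=> z; rewrite circle_coordE circle_proj_frac /circle_proj reprK. Qed.

Lemma circle_coord_proj x : circle_coord (circle_proj x) = frac_part x.
Proof.
rewrite circle_coordE.
have : repr (circle_proj x) == x %[mod (circle R)]%qT by rewrite reprK.
move/eqP/eqmodP => h; have {h} : repr (circle_proj x) - x \is a Num.int by [].
move=> /intrP[n rn].
by rewrite -(subrK x (repr _)) rn addrC frac_partDz.
Qed.

Lemma circle_coord_itv z : 0 <= circle_coord z < 1.
Proof. exact: frac_part_itv. Qed.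

Lemma continuous_circle_proj : continuous (@circle_proj R).
Proof. exact: pi_continuous. Qed.

(** The topology of the circle is the quotient topology. *)
Lemma continuous_circleP (Z : topologicalType) (f : circle R -> Z) :
  continuous (f \o @circle_proj R) -> continuous f.
Proof. by move=> cf; apply/quotient_continuous. Qed.

Lemma continuous_periodic (phi : R -> R) : continuous phi -> periodic1 phi ->
  continuous (fun z => phi (circle_coord z)).
Proof.
move=> cphi pphi; apply: continuous_circleP.
rewrite (_ : _ \o _ = phi)//; apply/funext => x /=.
by rewrite circle_coord_proj periodic1_frac.
Qed.

Lemma open_circle (U : set (circle R)) : open (circle_proj @^-1` U) -> open U.
Proof. by []. Qed.

Lemma measurable_open_circle (U : set (circle R)) : open U -> measurable U.
Proof. by move=> oU; exact: sub_sigma_algebra. Qed.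

Lemma measurable_circle_proj : measurable_fun setT (@circle_proj R).
Proof.
apply: (@measurability _ _ _ _ _ _ (@open (circle R))) => //.
move=> _ [U oU <-]; rewrite setTI.
apply: open_measurable.
by move/continuousP : continuous_circle_proj; exact.
Qed.

(** The coordinate is continuous except at 0; the preimages of the rays
    ]b, +oo[ with b >= 0 are nevertheless open, and these rays generate. *)
Lemma measurable_circle_coord : measurable_fun setT (@circle_coord R).
Proof.
move=> mD; apply: (measurability _ (RGenOInfty.measurableE R)) => //.
move=> _ [_ [b ->] <-]; rewrite setTI.
have [b0|b0] := ltP b 0.
  rewrite (_ : _ @^-1` _ = setT); first exact: measurableT.
  apply/seteqP; split=> // z _ /=; rewrite in_itv/= andbT.
  by rewrite (lt_le_trans b0)//; case/andP: (circle_coord_itv z).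
apply: measurable_open_circle; apply: open_circle.
rewrite (_ : _ @^-1` _ = \bigcup_(n in [set: int]) `]n%:~R + b, (n + 1)%:~R[%classic).
  by apply: bigcup_open => n _; exact: interval_open.
apply/seteqP; split=> x /=.
  rewrite in_itv/= andbT circle_coord_proj => bx.
  exists (Num.floor x) => //=; rewrite in_itv/= floorD1_gt andbT.
  by move: bx; rewrite /frac_part ltrBrDl.
move=> [n _]/=; rewrite !in_itv/= andbT circle_coord_proj => /andP[nx xn].
rewrite /frac_part (_ : Num.floor x = n) ?ltrBrDl//.
by apply: floor_def; rewrite xn andbT (le_trans _ (ltW nx))// lerDl.
Qed.

(** Periodic functions do not see the reductions modulo 1. *)
Lemma perturbed_periodic (phi : R -> R) (alpha t : R) z : periodic1 phi ->
  phi (circle_coord (perturbed_map (intermittent_map alpha) t z)) =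
  phi (intermittent_fun alpha (circle_coord z) + t).
Proof.
move=> pphi.
rewrite /perturbed_map circle_coord_proj periodic1_frac//.
rewrite /intermittent_map circle_coord_proj.
by rewrite /frac_part addrAC -mulrNz periodic1z.
Qed.

Lemma intermittent_periodic (phi : R -> R) (alpha : R) z : periodic1 phi ->
  phi (circle_coord (intermittent_map alpha z)) =
  phi (intermittent_fun alpha (circle_coord z)).
Proof.
by move=> pphi; rewrite /intermittent_map circle_coord_proj periodic1_frac.
Qed.

End circle_basics.

(** * Integration against probability measures *)

Lemma continuous_uniform_itv (R : realType) (phi : R -> R) (a b eta : R) :
  continuous phi -> 0 < eta ->
  exists2 e : R, 0 < e & forall x t, a <= x <= b -> `|t| <= e ->
    `|phi (x + t) - phi x| <= eta.
Proof.
move=> cphi eta0.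
have /compact_near_coveringP := @segment_compact R a b.
move=> /(_ R (nbhs (0 : R)) (fun t x => `|phi (x + t) - phi x| <= eta) _) h.
have [] : \forall t \near (0 : R), `[a, b] `<=` (fun x => `|phi (x + t) - phi x| <= eta).
  apply: h => x _.
  have eta2 : 0 < eta / 2 by rewrite divr_gt0.
  have h1 : \forall x' \near x & t \near (0 : R), `|phi (x' + t) - phi x| <= eta / 2.
    have c2 : (fun z : R * R => phi (z.1 + z.2)) z @[z --> (x, 0 : R)] --> phi (x + 0).
      apply: (@continuous_comp _ _ _ (fun z : R * R => z.1 + z.2) phi (x, 0)).
        exact: add_continuous.
      exact: cphi.
    rewrite addr0 in c2.
    by move/cvgrPdistC_le : c2 => /(_ _ eta2); apply: filterS => -[y1 y2].
  have h3 : \forall x' \near x & t \near (0 : R), `|phi x' - phi x| <= eta / 2.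
    have c2 : (fun z : R * R => phi z.1) z @[z --> (x, 0 : R)] --> phi x.
      apply: (@continuous_comp _ _ _ fst phi (x, 0)); last exact: cphi.
      exact: cvg_fst.
    by move/cvgrPdistC_le : c2 => /(_ _ eta2); apply: filterS => -[y1 y2].
  apply: filterS2 h1 h3 => -[x' t] /= b1 b2.
  rewrite -(subrK (phi x) (phi (x' + t))) -addrA.
  apply: (le_trans (ler_normD _ _)); rewrite [leRHS](splitr eta) lerD//.
  by rewrite distrC.
move=> e /= e0 eP; exists (e / 2); first by rewrite divr_gt0.
move=> x t xab te.
have /eP/(_ x) : ball_ Num.norm 0 e t.
  by rewrite /= sub0r normrN (le_lt_trans te)// ltr_pdivrMr// ltr_pMr// ltr1n.
by rewrite /= in_itv/= xab => /(_ isT).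
Unshelve. all: by end_near. Qed.

Lemma continuous_periodic_uniform (R : realType) (phi : R -> R) (eta : R) :
  continuous phi -> periodic1 phi -> 0 < eta ->
  exists2 e : R, 0 < e & forall x t, `|t| <= e -> `|phi (x + t) - phi x| <= eta.
Proof.
move=> cphi pphi eta0.
have [e e0 eP] := @continuous_uniform_itv R phi 0 1 eta cphi eta0.
exists e => // x t te; have /andP[f0 f1] := frac_part_itv x.
have := eP (frac_part x) t; rewrite f0 (ltW f1) => /(_ isT te).
rewrite periodic1_frac//; congr (`| _ - _ | <= _).
by rewrite /frac_part addrAC -mulrNz periodic1z.
Qed.

Lemma continuous_periodic_bounded (R : realType) (phi : R -> R) :
  continuous phi -> periodic1 phi ->
  exists2 M : R, 0 <= M & forall x, `|phi x| <= M.
Proof.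
move=> cphi pphi.
have cphi' : {within `[0, 1], continuous (fun x => `|phi x|)}.
  apply: continuous_subspaceT => x.
  apply: (@continuous_comp _ _ _ phi (fun y : R => `|y|)); first exact: cphi.
  exact: norm_continuous.
have [c _ hc] := @EVT_max R (fun x => `|phi x|) 0 1 ler01 cphi'.
exists `|phi c| => // x; rewrite -(periodic1_frac x pphi).
have /andP[f0 f1] := frac_part_itv x.
by apply: hc; rewrite in_itv/= f0 ltW.
Qed.

Section probability_integrals.
Context {d} {T : measurableType d} {R : realType} (P : probability T R).
Implicit Types f g : T -> R.

Lemma prob_integrable f (M : R) : measurable_fun setT f ->
  (forall x, `|f x| <= M) -> P.-integrable setT (EFin \o f).
Proof.
move=> mf fM; apply: measurable_bounded_integrable => //.
  by rewrite (le_lt_trans (probability_le1 P measurableT))// ltry.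
exists M; split; first exact: num_real.
by move=> M' MM' x _ /=; apply: (le_trans (fM x)); exact: ltW.
Qed.

Lemma prob_Rintegral_cst (c : R) : \int[P]_x c = c.
Proof.
rewrite Rintegral_cst//.
have e1 : fine (P [set: T]) = 1 by rewrite (probability_setT P).
by rewrite [X in c * X]e1 mulr1.
Qed.

Lemma prob_Rintegral_le f (c M : R) : measurable_fun setT f ->
  (forall x, `|f x| <= M) -> (forall x, f x <= c) -> \int[P]_x f x <= c.
Proof.
move=> mf fM fc; rewrite -[leRHS]prob_Rintegral_cst.
apply: le_Rintegral => //; first exact: prob_integrable fM.
by apply: (@prob_integrable _ `|c|).
Qed.

Lemma prob_Rintegral_norm_le f (M : R) : measurable_fun setT f ->
  (forall x, `|f x| <= M) -> `|\int[P]_x f x| <= M.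
Proof.
move=> mf fM; apply: (le_trans (le_normr_Rintegral _ _)) => //.
  exact: prob_integrable fM.
apply: (@prob_Rintegral_le _ M M) => //; first exact: measurableT_comp.
by move=> x; rewrite normr_id.
Qed.

Lemma prob_Rintegral_dist f g (M eta : R) : measurable_fun setT f ->
  measurable_fun setT g -> (forall x, `|f x| <= M) -> (forall x, `|g x| <= M) ->
  (forall x, `|f x - g x| <= eta) -> `|\int[P]_x f x - \int[P]_x g x| <= eta.
Proof.
move=> mf mg fM gM fg.
rewrite -RintegralB//; [|exact: prob_integrable fM|exact: prob_integrable gM].
by apply: prob_Rintegral_norm_le => //; exact: measurable_funB.
Qed.

End probability_integrals.

Lemma Rintegral_Fubini d1 d2 (T1 : measurableType d1) (T2 : measurableType d2)
  (R : realType) (P1 : probability T1 R) (P2 : probability T2 R)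
  (f : T1 * T2 -> R) (M : R) :
  measurable_fun setT f -> (forall z, `|f z| <= M) ->
  measurable_fun setT (fun x => \int[P2]_y f (x, y)) /\
  \int[P1]_x (\int[P2]_y f (x, y)) = \int[P2]_y (\int[P1]_x f (x, y)).
Proof.
move=> mf fM.
have intf : (P1 \x P2)%E.-integrable setT (EFin \o f) by exact: prob_integrable fM.
have m1 x : measurable_fun setT (fun y => f (x, y)).
  by apply: measurableT_comp => //; exact: measurable_pair1.
have m2 y : measurable_fun setT (fun x => f (x, y)).
  by apply: measurableT_comp => //; exact: measurable_pair2.
have F1 x : (\int[P2]_y (f (x, y))%:E)%E = (\int[P2]_y f (x, y))%:E.
  rewrite /Rintegral fineK//; apply: integrable_fin_num => //.
  by apply: (@prob_integrable _ _ _ _ _ M).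
have F2 y : (\int[P1]_x (f (x, y))%:E)%E = (\int[P1]_x f (x, y))%:E.
  rewrite /Rintegral fineK//; apply: integrable_fin_num => //.
  by apply: (@prob_integrable _ _ _ _ _ M).
have := Fubini intf; rewrite /=.
under eq_integral do rewrite F1.
under [in RHS]eq_integral do rewrite F2.
move=> e; split; last by rewrite /Rintegral e.
have := measurable_fubini_F intf; rewrite /fubini_F/=.
move=> h; apply/measurable_EFinP; move: h.
by congr (measurable_fun _ _); apply/funext => x; rewrite /= -F1.
Qed.

Lemma Rintegral_distribution d1 d2 (T1 : measurableType d1)
    (T2 : measurableType d2) (R : realType) (P : probability T1 R)
    (X : {mfun T1 >-> T2}) (phi : T2 -> R) (M : R) :
  measurable_fun setT phi -> (forall x, `|phi x| <= M) ->
  \int[distribution P X]_y phi y = \int[P]_x phi (X x).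
Proof.
move=> mphi phiM; congr fine.
have mE : measurable_fun setT (EFin \o phi) by exact/measurable_EFinP.
apply: (integral_distribution mE).
apply: (@prob_integrable _ _ _ P (fun x => phi (X x)) M) => //.
exact: (measurableT_comp mphi (measurable_funPT X)).
Qed.

Section circle_law.
Context {R : realType} (mu : probability (circle R) R).

Let coord (z : circle R) : measurableTypeR R := circle_coord z.

Let mcoord : measurable_fun setT coord.
Proof. by move=> _ A mA; exact: (measurable_circle_coord measurableT). Qed.

HB.instance Definition _ := isMeasurableFun.Build _ _ _ _ coord mcoord.

(** Measures on the circle are studied through the law of the coordinate, a
    measure on the line. *)
Definition circle_law : probability (measurableTypeR R) R :=
  distribution mu coord.

Lemma circle_lawE A : circle_law A = mu (@circle_coord R @^-1` A).
Proof. by []. Qed.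

Lemma Rintegral_circle_law (phi : R -> R) (M : R) :
  measurable_fun setT (phi : measurableTypeR R -> R) ->
  (forall x, `|phi x| <= M) ->
  \int[circle_law]_s phi s = \int[mu]_z phi (circle_coord z).
Proof.
exact: Rintegral_distribution.
Qed.

End circle_law.

(** * Stationary measures *)

Lemma measurable_intermittent (R : realType) (alpha : R) :
  measurable_fun setT (@intermittent_fun R alpha).
Proof.
rewrite /intermittent_fun; apply: measurable_fun_ifT.
- by apply: measurable_fun_ltr.
- apply: measurable_funD => //; apply: measurable_funM => //.
- apply: measurable_funB => //; apply: measurable_funM => //.
  apply: (measurableT_comp (measurable_powR _)) => //.
  exact: measurable_funB.
Qed.

(** The line is second countable: the complement of the support is covered by
    the countably many rational intervals of measure 0. *)
Lemma support_null (R : realType) (theta : probability (measurableTypeR R) R)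
  (e : R) : measure_support theta `<=` `[- e, e] -> theta (~` `[- e, e]) = 0%E.
Proof.
move=> supp.
pose I (pq : rat * rat) : set R := `]ratr pq.1, ratr pq.2[%classic.
pose F (n : nat) : set R :=
  if unpickle n is Some pq then if theta (I pq) == 0%E then I pq else set0
  else set0.
have mF n : measurable (F n).
  rewrite /F; case: unpickle => [pq|]; last exact: measurable0.
  by case: ifP => _; [exact: measurable_itv|exact: measurable0].
have F0 n : theta (F n) = 0%E.
  rewrite /F; case: unpickle => [pq|]; last exact: measure0.
  by case: ifP => [/eqP//|_]; exact: measure0.
have cover : ~` `[- e, e] `<=` \bigcup_n F n.
  move=> t te; have : ~ measure_support theta t by move=> /supp.
  move=> /existsNP[V] /not_implyP[oV] /not_implyP[Vt] /negP.
  rewrite -leNgt measure_le0 => /eqP V0.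
  have := open_nbhs_nbhs (conj oV Vt).
  rewrite -nbhs_ballE => -[d /= d0 dV].
  have [p] := @rat_in_itvoo R (t - d) t (ltac:(by rewrite ltrBlDr ltrDl)).
  have [q] := @rat_in_itvoo R t (t + d) (ltac:(by rewrite ltrDl)).
  rewrite !in_itv/= => /andP[tq qd] /andP[dp pt].
  have IV : I (p, q) `<=` V.
    move=> y; rewrite /I /= in_itv/= => /andP[py yq]; apply: dV.
    by rewrite /ball /= ltr_norml; lra.
  have I0 : theta (I (p, q)) = 0%E.
    apply/eqP; rewrite -measure_le0 -V0; apply: le_measure; rewrite ?inE//.
      exact: measurable_itv.
    exact: open_measurable.
  exists (pickle (p, q)); first exact: Logic.I.
  by rewrite /F pickleK I0 eqxx /I /= in_itv/= pt tq.
have nF : theta.-negligible (\bigcup_n F n).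
  by apply: negligible_bigcup => n; exists (F n); split; [exact: mF|exact: F0|].
have [A [mA A0 sA]] : theta.-negligible (~` `[- e, e]%classic).
  by have [A [mA A0 sA]] := nF; exists A; split=> //; exact: subset_trans sA.
apply/eqP; rewrite -measure_le0 -A0; apply: le_measure; rewrite ?inE//.
by apply: measurableC; exact: measurable_itv.
Qed.

(** The line carries two sigma-algebras that are equal but not syntactically
    so; this moves a function from one to the other. *)
Lemma measurable_to_R (R : realType) (phi : R -> R) :
  measurable_fun setT phi -> measurable_fun setT (phi : measurableTypeR R -> R).
Proof. by move=> mphi _ A mA; exact: (mphi measurableT). Qed.

Lemma measurable_frac_part (R : realType) : measurable_fun setT (@frac_part R).
Proof.
have -> : @frac_part R = @circle_coord R \o @circle_proj R.
  by apply/funext => x /=; rewrite circle_coord_proj.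
exact: (measurableT_comp (@measurable_circle_coord R) (@measurable_circle_proj R)).
Qed.

(** A lift of the circle map to the line: its values matter modulo 1. *)
Definition circle_lift (R : realType) (alpha s : R) : R :=
  intermittent_fun alpha (frac_part s).

Lemma measurable_circle_lift (R : realType) (alpha : R) :
  measurable_fun setT (circle_lift alpha).
Proof.
exact: (measurableT_comp (measurable_intermittent alpha) (@measurable_frac_part R)).
Qed.

Lemma circle_lift_coord (R : realType) (alpha : R) (z : circle R) :
  circle_lift alpha (circle_coord z) = intermittent_fun alpha (circle_coord z).
Proof. by rewrite /circle_lift frac_part_id// circle_coord_itv. Qed.

Lemma stationary_circle_law (R : realType) (alpha : R)
    (theta : probability (measurableTypeR R) R) (mu : probability (circle R) R) :
  stationary (intermittent_map alpha) theta mu ->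
  forall phi, continuous phi -> periodic1 phi ->
  \int[theta]_t (\int[circle_law mu]_s phi (circle_lift alpha s + t)) =
  \int[circle_law mu]_s phi s.
Proof.
move=> stat phi cphi pphi.
have [M M0 phiM] := continuous_periodic_bounded cphi pphi.
have mphi := continuous_measurable_fun cphi.
rewrite (Rintegral_circle_law mu (measurable_to_R mphi) phiM).
rewrite -(stat _ (continuous_periodic cphi pphi)).
apply: eq_Rintegral => t _.
have mft : measurable_fun setT (fun s => phi (circle_lift alpha s + t)).
  apply: (measurableT_comp mphi).
  by apply: measurable_funD => //; exact: measurable_circle_lift.
rewrite (Rintegral_circle_law mu (measurable_to_R mft) (fun=> phiM _)).
by apply: eq_Rintegral => z _; rewrite perturbed_periodic// circle_lift_coord.
Qed.

Section stationary_consequences.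
Context {R : realType} (f : R -> R) (mf : measurable_fun setT f) (e : R)
  (theta nu : probability (measurableTypeR R) R).
Context (stat : forall phi, continuous phi -> periodic1 phi ->
  \int[theta]_t (\int[nu]_s phi (f s + t)) = \int[nu]_s phi s)
  (theta_out : theta (~` `[- e, e]) = 0%E).
Context (phi : R -> R) (cphi : continuous phi) (pphi : periodic1 phi).

Let joint (ts : measurableTypeR R * measurableTypeR R) : R :=
  phi (f ts.2 + ts.1).

Let mjoint : measurable_fun setT joint.
Proof.
have mphi := continuous_measurable_fun cphi.
have m2 : measurable_fun setT
    (fun ts : measurableTypeR R * measurableTypeR R => f ts.2).
  exact: (measurableT_comp (measurable_to_R mf) measurable_snd).
have m1 : measurable_fun setT
    (fun ts : measurableTypeR R * measurableTypeR R => ts.1 : R).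
  have mid : measurable_fun setT (id : measurableTypeR R -> R).
    by apply: measurable_to_R; exact: measurable_id.
  exact: (measurableT_comp mid measurable_fst).
have m3 : measurable_fun setT
    (fun ts : measurableTypeR R * measurableTypeR R => f ts.2 + ts.1 : R).
  exact: measurable_funD.
exact: (measurableT_comp mphi m3).
Qed.

Let mslice (t : R) : measurable_fun setT
  ((fun s => phi (f s + t)) : measurableTypeR R -> R).
Proof.
apply: measurable_to_R.
apply: (measurableT_comp (continuous_measurable_fun cphi)).
exact: measurable_funD.
Qed.

Lemma stationary_swap :
  \int[nu]_s (\int[theta]_t phi (f s + t)) = \int[nu]_s phi s.
Proof.
have [M M0 phiM] := continuous_periodic_bounded cphi pphi.
rewrite -(stat cphi pphi).
have [_ h] := @Rintegral_Fubini _ _ _ _ _ theta nu joint M mjoint (fun=> phiM _).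
exact: esym h.
Qed.

Lemma measurable_noise_average : measurable_fun setT
  ((fun s => \int[theta]_t phi (f s + t)) : measurableTypeR R -> R).
Proof.
have [M M0 phiM] := continuous_periodic_bounded cphi pphi.
have mjoint' := measurableT_comp mjoint
  (@measurable_swap _ _ (measurableTypeR R) (measurableTypeR R)).
by have [] := @Rintegral_Fubini _ _ _ _ _ nu theta _ M mjoint' (fun=> phiM _).
Qed.

(** The integrals of phi (f s + t) average to that of phi over t, and the
    noise is carried by [-e, e]: were all of them smaller by eta there, so would
    be their average. *)
Lemma stationary_shift (eta : R) : 0 < eta -> exists2 t, `|t| <= e &
  \int[nu]_s phi s <= \int[nu]_s phi (f s + t) + eta.
Proof.
move=> eta0; apply: contrapT => H.
have [M M0 phiM] := continuous_periodic_bounded cphi pphi.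
set I := \int[nu]_s phi s in H.
pose J (t : measurableTypeR R) := \int[nu]_s phi (f s + t).
have mJ : measurable_fun setT J.
  by have [] := @Rintegral_Fubini _ _ _ _ _ theta nu joint M mjoint (fun=> phiM _).
have JM t : `|J t| <= M.
  by apply: prob_Rintegral_norm_le => //; exact: mslice.
have JI t : `|t| <= e -> J t <= I - eta.
  move=> te; rewrite leNgt; apply/negP => h; apply: H; exists t => //.
  by rewrite -lerBlDr ltW.
(* J' agrees with J almost everywhere and is bounded everywhere. *)
pose J' t := Num.min (J t) (I - eta).
have mJ' : measurable_fun setT J' by exact: measurable_minr.
have : \int[theta]_t J t <= I - eta.
  have -> : \int[theta]_t J t = \int[theta]_t J' t.
    congr fine; apply: ae_eq_integral => //; try exact/measurable_EFinP.
    exists (~` `[- e, e]); split => //.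
      by apply: measurableC; exact: measurable_itv.
    move=> t /= nt; apply: contra_not nt; rewrite in_itv/= -ler_norml => te _.
    by rewrite /J' min_l// JI.
  apply: (@prob_Rintegral_le _ _ _ _ _ _ (M + `|I - eta|)) => //.
    move=> t; rewrite /J' /Num.min; case: ifP => _.
      by rewrite (le_trans (JM t))// lerDl.
    by rewrite lerDr.
  by move=> t; rewrite /J' ge_min lexx orbT.
by rewrite /J (stat cphi pphi) -/I; lra.
Qed.

End stationary_consequences.

(** * Rapidly varying functions against an absolutely continuous noise *)

(** The difference quotients of a primitive are C1 approximations. *)
Lemma primitive_quotient (R : realType) (h : R -> R) (eta : R) :
  continuous h -> 0 < eta ->
  exists hd dhd : R -> R, [/\ continuous dhd,
    forall x : R, is_derive x 1 hd (dhd x) &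
    forall x : R, -1 <= x <= 1 -> `|h x - hd x| <= eta].
Proof.
move=> ch eta0.
have [del del0 hdel] := @continuous_uniform_itv R h (- 1) 1 eta ch eta0.
have [H [_ dH]] := primitive ch.
have cH : continuous H by move=> x; exact: is_derive_continuous (dH x).
exists (fun x => del^-1 * (H (x + del) - H x)).
exists (fun x => del^-1 * (h (x + del) - h x)); split.
- have c1 : continuous (fun x => h (x + del)).
    by apply: (@cont_comp _ h (fun x => x + del)) => //; solve_cont.
  by solve_cont.
- move=> x; apply: is_derive1Mc; apply: is_derive1B => //.
  have := @is_derive1o _ H (fun y => y + del) _ _ _ (dH _)
    (is_derive1D (is_derive1_id x) (is_derive1_c del x)).
  by rewrite addr0 mulr1.
- move=> x x1.
  have xd : x < x + del by rewrite ltrDl.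
  have dH' (y : R) : y \in `]x, (x + del)[ -> is_derive y 1 H (h y) by [].
  have [|y yx ->] := MVT xd dH'; first exact: continuous_subspaceT.
  rewrite addrAC subrr add0r mulrCA mulVf ?gt_eqF// mulr1 distrC.
  move: yx; rewrite in_itv/= => /andP[xy yx].
  have := hdel x (y - x) x1; rewrite (_ : x + (y - x) = y); last by ring.
  apply.
  by rewrite ger0_norm; lra.
Qed.

Section absolutely_continuous_noise.
Context {R : realType}.
Notation leb := (@lebesgue_measure R).
Notation E := (`[-1, 1]%classic : set (measurableTypeR R)).

Let mE : measurable E. Proof. exact: measurable_itv. Qed.

Let leb_E2 : leb E = 2%:E.
Proof.
rewrite lebesgue_measure_itv/= lte_fin (_ : -1 < 1 :> R); last by lra.
by rewrite -EFinB opprK; congr (_%:E); ring.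
Qed.

Let leb_E : (leb E < +oo)%E. Proof. by rewrite leb_E2 ltry. Qed.

Let fine_leb_E : fine (leb E) = 2. Proof. by rewrite leb_E2. Qed.

Let int_continuous (h : R -> R) : continuous h -> leb.-integrable E (EFin \o h).
Proof.
move=> ch; apply: continuous_compact_integrable; first exact: segment_compact.
exact: continuous_subspaceT.
Qed.

(** Integration by parts: only the bound on [psi] matters, not the one on
    its derivative. *)
Lemma C1_oscillation_le (hd dhd : R -> R) : continuous dhd ->
  (forall x : R, is_derive x 1 hd (dhd x)) ->
  exists K : R, forall psi phi : R -> R, C1circle psi phi ->
    (forall x, `|psi x| <= 1) -> `|\int[leb]_(x in E) (phi x * hd x)| <= K.
Proof.
move=> cdhd dhdE.
have chd : continuous hd by move=> x; exact: is_derive_continuous (dhdE x).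
have lt11 : (-1 : R) < 1 by lra.
have ca : {within `[-1, 1], continuous (fun x => `|dhd x|)}.
  exact: continuous_subspaceT (cont_norm cdhd).
have [c _ hc] := @EVT_max R (fun x => `|dhd x|) (-1) 1 (ltW lt11) ca.
exists (`|hd 1| + `|hd (-1)| + `|dhd c| * 2) => psi phi [ppsi cphi pphi dpsi] psi1.
have cpsi : continuous psi by move=> x; exact: is_derive_continuous (dpsi x).
have dprod (x : R) : is_derive x 1 (fun y => psi y * hd y) (phi x * hd x + psi x * dhd x).
  exact: is_derive1M.
have FTC : \int[leb]_(x in E) (phi x * hd x + psi x * dhd x) =
    psi 1 * hd 1 - psi (-1) * hd (-1).
  rewrite /Rintegral (@continuous_FTC2 R _ (fun y => psi y * hd y) (-1) 1)//.
  - by apply: continuous_subspaceT; solve_cont.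
  - split.
    + by move=> x _; have [] := dprod x.
    + apply: cvg_at_right_filter; exact: is_derive_continuous (dprod _).
    + apply: cvg_at_left_filter; exact: is_derive_continuous (dprod _).
  - by move=> x _; rewrite derive1E; have [] := dprod x.
rewrite RintegralD// in FTC; last 2 first.
- by apply: int_continuous; solve_cont.
- by apply: int_continuous; solve_cont.
have i2 : `|\int[leb]_(x in E) (psi x * dhd x)| <= `|dhd c| * 2.
  apply: (le_trans (le_normr_Rintegral _ _)) => //.
    by apply: int_continuous; solve_cont.
  apply: (@le_trans _ _ (\int[leb]_(x in E) (cst `|dhd c| x))).
    apply: le_Rintegral => //.
    - have cn : continuous (fun x => `|psi x * dhd x|).
        by apply: cont_norm; solve_cont.
      exact: int_continuous.
    - by apply: int_continuous; exact: cst_continuous.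
    - move=> x xE; rewrite normrM -[leRHS]mul1r ler_pM//.
      by apply: hc.
  by rewrite Rintegral_cst// [X in _ * X]fine_leb_E.
have -> : \int[leb]_(x in E) (phi x * hd x) =
  psi 1 * hd 1 - psi (-1) * hd (-1) - \int[leb]_(x in E) (psi x * dhd x).
  by rewrite -FTC addrK.
apply: (le_trans (ler_normB _ _)); apply: lerD => //.
apply: (le_trans (ler_normB _ _)); apply: lerD.
  by rewrite normrM ler_piMl.
by rewrite normrM ler_piMl.
Qed.

(** The density is approximated in L1 by a C1 function: the error is
    proportional to the sup norm of [phi], with a coefficient as small as
    desired, and integration by parts bounds the main term. *)
Lemma absolutely_continuous_oscillation (theta : probability (measurableTypeR R) R) :
  theta `<< leb -> theta (~` E) = 0%E ->
  forall eta : R, 0 < eta -> exists K : R,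
  forall (psi phi : R -> R) (M : R), C1circle psi phi ->
    (forall x, `|psi x| <= 1) -> (forall x, `|phi x| <= M) ->
    `|\int[theta]_t phi t| <= eta * M + K.
Proof.
move=> ac out eta eta0.
pose q := charge_of_finite_measure theta.
pose g := Radon_Nikodym q leb.
pose G := fine \o g.
have ac' : q `<< leb by exact: ac.
have gG x : g x = (G x)%:E by rewrite /G /= fineK// Radon_Nikodym_fin_num.
have ig : leb.-integrable E (EFin \o G).
  have -> : EFin \o G = g by apply/funext => x; rewrite /= -gG.
  apply: (integrableS measurableT mE (@subsetT _ _)).
  exact: Radon_Nikodym_integrable.
have [h_ [ch ih cvgh]] := approximation_continuous_integrable mE leb_E ig.
have eta2 : 0 < eta / 2 by rewrite divr_gt0.
have [h [{}ch {}ih hG]] : exists h : R -> R, [/\ continuous h, leb.-integrable E (EFin \o h) &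
    (\int[leb]_(z in E) `|(G z - h z)%:E| < (eta / 2)%:E)%E].
  have : \forall n \near \oo, (\int[leb]_(z in E) `|(G z - h_ n z)%:E| < (eta / 2)%:E)%E.
    move/fine_cvgP : cvgh => [nfin /cvgr_lt /(_ _ eta2) nlt].
    by apply: filterS2 nfin nlt => n /= finn ltn; rewrite -(fineK finn) lte_fin.
  by move=> [n _ hn]; exists (h_ n); split=> //; exact: (hn n (leqnn n)).
have [hd [dhd [cdhd dhdE hhd]]] := primitive_quotient ch (ltac:(by rewrite divr_gt0) : 0 < eta / 4).
have [K hK] := C1_oscillation_le cdhd dhdE.
exists K => psi phi M C1 psi1 phiM.
have [ppsi cphi pphi dpsi] := C1.
have M0 : 0 <= M by rewrite (le_trans _ (phiM 0)).
have chd : continuous hd by move=> x; exact: is_derive_continuous (dhdE x).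
have mphi : measurable_fun setT (phi : measurableTypeR R -> R).
  exact: measurable_to_R (continuous_measurable_fun cphi).
have iphi := @prob_integrable _ _ _ theta (phi : measurableTypeR R -> R) M mphi phiM.
have iphiE : theta.-integrable E (EFin \o phi).
  exact: (integrableS measurableT mE (@subsetT _ _) iphi).
have mG : measurable_fun E G by case/integrableP : ig => /measurable_EFinP.
have mh : measurable_fun E h by case/integrableP : ih => /measurable_EFinP.
have mphiE : measurable_fun E (phi : measurableTypeR R -> R) by exact: measurable_funTS.
have RN : \int[theta]_t phi t = \int[leb]_(x in E) (phi x * G x).
  congr fine.
  rewrite (negligible_integral (measurableC mE) measurableT iphi out).
  rewrite setDE setCK setTI.
  rewrite -(Radon_Nikodym_change_of_variables ac mE iphiE).
  by apply: eq_integral => x _; rewrite EFinM -gG.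
have iGh : leb.-integrable E (EFin \o (fun x => G x - h x)).
  by apply: (integrableB mE ig ih).
have i1 : leb.-integrable E (EFin \o (fun x => phi x * (G x - h x))).
  apply: (@le_integrable _ _ _ _ _ mE _ (EFin \o (fun x => M * (G x - h x)))).
  - by apply/measurable_EFinP; apply: measurable_funM => //; exact: measurable_funB.
  - move=> x _ /=; rewrite lee_fin !normrM (ger0_norm M0).
    by rewrite ler_wpM2r.
  - exact: (integrableZl mE M iGh).
have i2 : leb.-integrable E (EFin \o (fun x => phi x * (h x - hd x))).
  by apply: int_continuous; solve_cont.
have i3 : leb.-integrable E (EFin \o (fun x => phi x * hd x)).
  by apply: int_continuous; solve_cont.
have split_int : \int[leb]_(x in E) (phi x * G x) =
    \int[leb]_(x in E) (phi x * (G x - h x)) +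
    \int[leb]_(x in E) (phi x * (h x - hd x)) +
    \int[leb]_(x in E) (phi x * hd x).
  rewrite -RintegralD// -RintegralD//.
    by apply: eq_Rintegral => x _; ring.
  exact: (integrableD mE i1 i2).
have b1 : `|\int[leb]_(x in E) (phi x * (G x - h x))| <= M * (eta / 2).
  apply: (le_trans (le_normr_Rintegral _ _)) => //.
  have iN := integrable_norm iGh.
  apply: (@le_trans _ _ (\int[leb]_(x in E) (M * `|G x - h x|))).
    apply: le_Rintegral => //.
    - exact: (integrable_norm i1).
    - exact: (integrableZl mE M iN).
    - by move=> x _; rewrite normrM ler_wpM2r.
  rewrite RintegralZl// ler_wpM2l// -lee_fin fineK//; last exact: integrable_fin_num.
  exact: ltW.
have b2 : `|\int[leb]_(x in E) (phi x * (h x - hd x))| <= M * (eta / 2).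
  apply: (le_trans (le_normr_Rintegral _ _)) => //.
  apply: (@le_trans _ _ (\int[leb]_(x in E) (cst (M * (eta / 4)) x))).
    apply: le_Rintegral => //.
    - exact: (integrable_norm i2).
    - by apply: int_continuous; exact: cst_continuous.
    - by move=> x xE; rewrite normrM ler_pM//; exact: hhd.
  rewrite Rintegral_cst// [X in _ * X]fine_leb_E.
  by rewrite (_ : M * (eta / 4) * 2 = M * (eta / 2))//; field.
rewrite RN split_int.
have b3 := hK psi phi C1 psi1.
apply: (le_trans (ler_normD _ _)); apply: lerD => //.
apply: (le_trans (ler_normD _ _)); apply: (le_trans (lerD b1 b2)).
by rewrite (_ : M * (eta / 2) + M * (eta / 2) = eta * M)//; field.
Qed.

End absolutely_continuous_noise.

(** * A bound on stationary integrals uniform in the noise *)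

(** Stationarity is used twice: to transport the inequality along the N steps
    of the iteration, and at the end to average phi_N over the noise, which makes
    its integral o(N). *)
Lemma stationary_C1_bound (R : realType) (alpha r e delta : R)
  (theta nu : probability (measurableTypeR R) R) :
  0 < alpha < 1 -> 0 < r <= 4^-1 -> r <= delta -> small_noise alpha r e -> e <= 1 ->
  theta `<< @lebesgue_measure R -> theta (~` `[- e, e]) = 0%E ->
  (forall phi, continuous phi -> periodic1 phi ->
    \int[theta]_t (\int[nu]_s phi (circle_lift alpha s + t)) =
    \int[nu]_s phi s) ->
  forall psi0 phi0 : R -> R, C1circle psi0 phi0 ->
  (forall x : R, 0 <= x <= 1 ->
     `|psi0 x| <= gain alpha * (delta * pw alpha delta)) ->
  (forall x : R, 0 <= x <= 1 -> x < delta \/ 1 - delta < x -> psi0 x = 0) ->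
  \int[nu]_s phi0 s <= step_error r + 1.
Proof.
move=> alpha01 r01 rdelta small e1 ac out stat psi0 phi0 C0 psi0_le psi0_supp.
have r1 : r <= 1 by lra.
have [_ cphi0 pphi0 _] := C0.
have [M0 M00 phi0M] := continuous_periodic_bounded cphi0 pphi0.
set C := step_error r.
have C0' : 0 <= C.
  by rewrite /C /step_error addr_ge0// divr_ge0// divr_ge0//; lra.
set I0 := \int[nu]_s phi0 s.
have mf := measurable_circle_lift alpha.
have intnu (phi : R -> R) : continuous phi -> periodic1 phi ->
    nu.-integrable setT (EFin \o phi).
  move=> cphi pphi; have [M _ phiM] := continuous_periodic_bounded cphi pphi.
  apply: (@prob_integrable _ _ _ nu (phi : measurableTypeR R -> R) M _ phiM).
  exact: measurable_to_R (continuous_measurable_fun cphi).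
have iter (N : nat) : exists psi phi : R -> R, [/\ C1circle psi phi,
    forall y, `|psi y| <= Num.max `|y| r,
    forall x, `|phi x| <= N%:R * (M0 + C) &
    N%:R * (I0 - C - 1) <= \int[nu]_s phi s].
  elim: N => [|N [psi [phi [C1 cap phiM IH]]]].
    exists (fun=> 0), (fun=> 0); split.
    - by split=> //; [exact: cst_continuous|move=> x; exact: is_derive1_c].
    - by move=> y; rewrite normr0 le_max normr_ge0.
    - by move=> x; rewrite normr0 mul0r.
    - by rewrite prob_Rintegral_cst mul0r.
  have [_ cphi pphi _] := C1.
  (* Each step loses the error of the transfer and the slack 1 in the shift. *)
  have [t te tint] := stationary_shift mf stat out cphi pphi ltr01.
  have [psi' [phi' [C1' cap' err]]] :=
    transfer_step alpha01 r01 rdelta small C0 psi0_le psi0_supp C1 cap te.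
  have [_ cphi' pphi' _] := C1'.
  have err' x : `|phi' x - (phi0 x + phi (circle_lift alpha x + t))| <= C.
    have := err _ (frac_part_itv x).
    by rewrite (periodic1_frac _ pphi') (periodic1_frac _ pphi0).
  exists psi', phi'; split=> //.
  - move=> x; have := err' x; have := phi0M x; have := phiM (circle_lift alpha x + t).
    rewrite -natr1 !ler_norml; lra.
  - have mlift : measurable_fun setT
        ((fun s => phi (circle_lift alpha s + t)) : measurableTypeR R -> R).
      apply: measurable_to_R.
      apply: (measurableT_comp (continuous_measurable_fun cphi)).
      exact: measurable_funD.
    have ilift := @prob_integrable _ _ _ nu _ _ mlift (fun=> phiM _).
    have i0 := intnu _ cphi0 pphi0; have i' := intnu _ cphi' pphi'.
    have icst := @prob_integrable _ _ _ nu (fun=> - C) C (measurable_cst _)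
      (fun=> ltac:(by rewrite normrN ger0_norm)).
    have i0l := integrableD measurableT i0 ilift.
    have : \int[nu]_s ((phi0 s + phi (circle_lift alpha s + t)) + - C) <= \int[nu]_s phi' s.
      apply: le_Rintegral => //.
        exact: (integrableD measurableT i0l icst).
      by move=> x _; have := err' x; rewrite ler_norml; lra.
    rewrite (RintegralD measurableT i0l icst) (RintegralD measurableT i0 ilift).
    rewrite prob_Rintegral_cst -/I0 -natr1 mulrDl mul1r.
    by move: IH tint; lra.
have mphi_osc (eta : R) : 0 < eta -> I0 - C - 1 <= eta.
  move=> eta0.
  pose eta' := eta / (2 * (M0 + C + 1)).
  have B0 : 0 < M0 + C + 1 by rewrite ltr_wpDl// addr_ge0.
  have eta'0 : 0 < eta' by rewrite divr_gt0// mulr_gt0.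
  have outE : theta (~` `[-1, 1]%classic) = 0%E.
    apply/eqP; rewrite -measure_le0 -out; apply: le_measure; rewrite ?inE.
    - by apply: measurableC; exact: measurable_itv.
    - by apply: measurableC; exact: measurable_itv.
    - move=> x /= nx; apply: contra_not nx; rewrite !in_itv/=; lra.
  have [K hK] := absolutely_continuous_oscillation ac outE eta'0.
  pose N := (Num.trunc (2 * `|K| / eta)).+1.
  have N0 : (0 : R) < N%:R by rewrite ltr0n.
  have NK : K <= N%:R * (eta / 2).
    apply: (le_trans (ler_norm K)).
    have := ltW (truncnS_gt (2 * `|K| / eta)); rewrite -/N.
    rewrite ler_pdivrMr// => h.
    by rewrite mulrA ler_pdivlMr// mulrC.
  have [psi [phi [C1 cap phiM IH]]] := iter N.
  have [ppsi cphi pphi dpsi] := C1.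
  have psi1 := @periodic_cap_le1 _ _ _ r1 ppsi cap.
  have avg s : `|\int[theta]_t phi (circle_lift alpha s + t)| <=
      eta' * (N%:R * (M0 + C)) + K.
    pose y := circle_lift alpha s.
    apply: (hK (fun t => psi (y + t)) (fun t => phi (y + t))).
    - split.
      + by move=> t; rewrite addrA ppsi.
      + by apply: (@cont_comp _ phi (fun t => y + t)) => //; solve_cont.
      + by move=> t; rewrite addrA pphi.
      + move=> t.
        have := @is_derive1o _ psi (fun t => y + t) _ _ _ (dpsi _)
          (is_derive1D (is_derive1_c y t) (is_derive1_id t)).
        by rewrite add0r mulr1.
    - by move=> t; exact: psi1.
    - by move=> t; exact: phiM.
  have le1 : \int[nu]_s phi s <= eta' * (N%:R * (M0 + C)) + K.
    rewrite -(stationary_swap mf stat cphi pphi).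
    have := prob_Rintegral_norm_le nu (measurable_noise_average mf theta nu cphi pphi) avg.
    by move=> /(le_trans (ler_norm _)).
  have le2 : eta' * (N%:R * (M0 + C)) <= N%:R * (eta / 2).
    have -> : eta' * (N%:R * (M0 + C)) =
        N%:R * (eta / 2) * ((M0 + C) / (M0 + C + 1)).
      by rewrite /eta'; field; rewrite gt_eqF.
    apply: ler_piMr; first by rewrite mulr_ge0 ?(ltW N0)// divr_ge0// ltW.
    by rewrite ler_pdivrMr// mul1r lerDl.
  rewrite -(ler_pM2l N0); apply: (le_trans IH); apply: (le_trans le1).
  by apply: (le_trans (lerD le2 NK)); rewrite -mulrDr -splitr.
rewrite -subr_ge0 leNgt; apply/negP => h.
have := mphi_osc ((I0 - C - 1) / 2); lra.
Qed.

(** * Density of the limit measure away from the fixed point *)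

Lemma small_noise_exists (R : realType) (alpha delta : R) :
  0 < alpha < 1 -> 0 < delta ->
  exists r e1 : R, [/\ 0 < r <= 4^-1, r <= delta, 0 < e1 &
    forall e, 0 <= e <= e1 -> small_noise alpha r e].
Proof.
move=> alpha01 d0; set L := gain alpha * (4^-1 * pw alpha 4^-1).
have L0 : 0 < L by rewrite mulr_gt0 ?gain_gt0// mulr_gt0 ?pw_gt0 ?invr_gt0.
pose r := Num.min delta (Num.min 4^-1 (L / 2)).
have r0 : 0 < r by rewrite !lt_min d0 invr_gt0 divr_gt0// ltr0n.
have rd : r <= delta by rewrite ge_min lexx.
have r4 : r <= 4^-1 by rewrite !ge_min lexx orbT.
have rL : r <= L / 2 by rewrite !ge_min lexx !orbT.
have r40 : 0 < r / 4 by rewrite divr_gt0.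
set L1 := gain alpha * (r / 4 * pw alpha (r / 4)).
have L10 : 0 < L1 by rewrite mulr_gt0 ?gain_gt0// mulr_gt0 ?pw_gt0.
exists r, (Num.min (r / 2) (Num.min L1 (L / 2))); split=> //.
- by rewrite r0.
- by rewrite !lt_min L10 !divr_gt0.
- move=> e /andP[e0]; rewrite !le_min => /and3P[er eL1 eL].
  by split=> //; rewrite -/L [leRHS]splitr lerD.
Qed.

(** Two functions are approximated at the same noise level, which is what the
    comparison of phi with phi o T requires. *)
Lemma weak_star_cluster (R : realType) (mu : R -> probability (circle R) R)
    (mu0 : probability (circle R) R) :
  cluster ((mu : R -> weak_star R) @ (0 : R)^'+) (mu0 : weak_star R) ->
  forall (phi1 phi2 : circle R -> R) (e0 eta : R),
  continuous phi1 -> continuous phi2 -> 0 < e0 -> 0 < eta ->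
  exists e, [/\ 0 < e < e0,
    `|\int[mu e]_z phi1 z - \int[mu0]_z phi1 z| <= eta &
    `|\int[mu e]_z phi2 z - \int[mu0]_z phi2 z| <= eta].
Proof.
move=> clu phi1 phi2 e0 eta c1 c2 e00 eta0.
pose near0 (phi : circle R -> R) : set (weak_star R) :=
  [set m | `|\int[m : probability (circle R) R]_z phi z - \int[mu0]_z phi z| <= eta].
have nb (phi : circle R -> R) : continuous phi -> nbhs (mu0 : weak_star R) (near0 phi).
  move=> cphi.
  pose phiC : continuousType (circle R) R := mkcts cphi.
  have cI : {for (mu0 : weak_star R), continuous (@integral_functional R : weak_star R -> _)}.
    exact: (@initial_continuous _ _ (@integral_functional R)).
  have cE : continuous (fun F : {ptws continuousType (circle R) R -> R} => F phiC).
    exact: (@proj_continuous _ (fun=> R) phiC).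
  have cc := continuous_comp cI (cE _).
  by move/cvgrPdist_le : cc => /(_ _ eta0); apply: filterS => m; rewrite distrC.
have [|m [[e ee <-] [h1 h2]]] := clu (mu @` [set e | 0 < e < e0]) _ _ (filterI (nb _ c1) (nb _ c2)).
  have : \forall e \near (0 : R)^'+, 0 < e < e0.
    by apply: filterS2 (nbhs_right_gt (0 : R)) (nbhs_right_lt e00) => e -> ->.
  by apply: filterS => e ee; exists e.
by exists e.
Qed.

(** A function on the line whose values and derivatives agree at 0 and 1
    extends periodically. *)
Lemma cell_C1circle (R : realType) (Psi dPsi : R -> R) :
  continuous dPsi -> (forall x : R, is_derive x 1 Psi (dPsi x)) ->
  Psi 0 = Psi 1 -> dPsi 0 = dPsi 1 ->
  exists psi phi : R -> R, C1circle psi phi /\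
    forall x, 0 <= x <= 1 -> psi x = Psi x /\ phi x = dPsi x.
Proof.
move=> cd dP P01 d01.
have cP : continuous Psi by move=> x; exact: is_derive_continuous (dP x).
have c1 : continuous (fun x : R => 1 - x) by solve_cont.
have dP2 (x : R) : 0 < x < 2^-1 ->
    is_derive x 1 (fun x => Psi (1 - x)) (- dPsi (1 - x)).
  move=> _; have := @is_derive1o _ Psi (fun x => 1 - x) _ _ _ (dP _)
    (is_derive1B (is_derive1_c 1 x) (is_derive1_id x)).
  by rewrite sub0r mulrN1.
have h : 1 - 2^-1 = 2^-1 :> R by field.
have := @C1circle_glue R Psi dPsi (fun x => Psi (1 - x)) (fun x => - dPsi (1 - x))
  cP (cont_comp cP c1) cd (contN (cont_comp cd c1)) (fun x _ => dP x) dP2.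
rewrite /= !subr0 h !opprK => /(_ P01 erefl d01 erefl).
move=> [psi [phi [C1 h1 h2]]]; exists psi, phi; split=> // x /andP[x0 x1].
have [xh|/ltW xh] := leP x 2^-1; first by apply: h1; rewrite x0.
have xh1 : 2^-1 <= x <= 1 by rewrite xh.
have [-> ->] := h2 _ xh1.
by rewrite opprK (_ : 1 - (1 - x) = x)//; ring.
Qed.

(** The function is lam/2 atan((x - c)/h) times a cutoff.  The first factor
    increases, with slope of order 1/h on [c - h, c + h], and its amplitude does
    not depend on h; the cutoff costs a bounded amount D. *)
Lemma interval_test_function (R : realType) (delta lam : R) :
  0 < delta < 4^-1 -> 0 < lam ->
  exists D B : R, [/\ 0 <= D, 0 < B &
    forall c h : R, 0 < h -> 2 * delta <= c - h -> c + h <= 1 - 2 * delta ->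
    exists psi phi : R -> R, [/\ C1circle psi phi,
      forall x : R, 0 <= x <= 1 -> `|psi x| <= lam,
      forall x : R, 0 <= x <= 1 -> x < delta \/ 1 - delta < x -> psi x = 0,
      forall x : R, - D <= phi x &
      forall x : R, c - h <= x <= c + h -> B / h - D <= phi x]].
Proof.
move=> d01 lam0.
pose w : R := 2^-1 - delta.
have w0 : 0 < w by rewrite /w; lra.
pose u0 : R := (2^-1 - 2 * delta) / w.
have u01 : 0 < u0 < 1.
  rewrite /u0 divr_gt0//=; last by lra.
  by rewrite ltr_pdivrMr// /w; lra.
have b0 : 0 < 1 - u0 ^+ 2 by rewrite subr_gt0 expr_lt1//; lra.
pose B := lam / 2 / 2 * (1 - u0 ^+ 2) ^+ 2.
pose D := lam / 2 * 2 * (4 / w).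
exists D, B; split.
- by rewrite /D !mulr_ge0 ?invr_ge0// ltW.
- by rewrite /B !mulr_gt0 ?invr_gt0// exprn_gt0.
move=> c h h0 ch1 ch2.
pose s := lam / 2.
have s0 : 0 < s by rewrite divr_gt0.
pose q (x : R) := (x - 2^-1) / w.
pose Psi (x : R) := s * (atan ((x - c) / h) * bump (q x)).
pose dPsi (x : R) := s * ((1 + ((x - c) / h) ^+ 2)^-1 * h^-1 * bump (q x) +
   atan ((x - c) / h) * (dbump (q x) * w^-1)).
have dlin (a b x : R) : is_derive x 1 (fun x => (x - a) / b) (b^-1).
  have := is_derive1Mc b^-1 (is_derive1B (is_derive1_id x) (is_derive1_c a x)).
  by rewrite subr0 mulr1; under eq_fun do rewrite mulrC.
have dP (x : R) : is_derive x 1 Psi (dPsi x).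
  have d1 := @is_derive1o R (@atan R) (fun x => (x - c) / h) x _ _
    (is_derive1_atan _) (dlin _ _ _).
  have d2 := @is_derive1o R (@bump R) q x _ _ (is_derive_bump _) (dlin _ _ _).
  exact: is_derive1Mc (is_derive1M d1 d2).
have cd : continuous dPsi.
  have clin (a b : R) : continuous (fun x => (x - a) / b) by solve_cont.
  have c1 : continuous (fun x => bump (q x)).
    exact: (@cont_comp _ bump q (@continuous_bump R) (clin _ _)).
  have c2 : continuous (fun x => dbump (q x)).
    exact: (@cont_comp _ dbump q (@continuous_dbump R) (clin _ _)).
  have c3 : continuous (fun x => atan ((x - c) / h)).
    exact: (@cont_comp _ atan _ (@continuous_atan R) (clin _ _)).
  have c4 : continuous (fun x => (1 + ((x - c) / h) ^+ 2)^-1).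
    apply: contV; first by solve_cont.
    by move=> x; rewrite gt_eqF// ltr_wpDr ?sqr_ge0.
  by rewrite /dPsi; solve_cont.
have qfar (x : R) : x <= delta \/ 1 - delta <= x -> bump (q x) = 0 /\ dbump (q x) = 0.
  move=> xd; apply: bump_ge1; rewrite /q normrM normfV (gtr0_norm w0).
  rewrite ler_pdivlMr// mul1r ler_normr /w; apply/orP.
  by case: xd => ?; [right|left]; lra.
have [f0 g0] := qfar 0 (ltac:(left; lra)).
have [f1 g1] := qfar 1 (ltac:(right; lra)).
have P01 : Psi 0 = Psi 1 by rewrite /Psi f0 f1 !mulr0.
have d01' : dPsi 0 = dPsi 1 by rewrite /dPsi f0 f1 g0 g1 !(mul0r, mulr0, addr0).
have [psi [phi [C1 E]]] := cell_C1circle cd dP P01 d01'.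
have [_ _ pphi _] := C1.
have atan2 (x : R) : `|atan x| <= 2.
  have := atan_gtNpi2 x; have := atan_ltpi2 x; have := @pihalf_lt2 R.
  by rewrite ler_norml; lra.
have second (x : R) : - D <= s * (atan ((x - c) / h) * (dbump (q x) * w^-1)).
  rewrite lerNl -mulrN; apply: (@le_trans _ _ (s * (2 * (4 / w)))); last first.
    by have -> : s * (2 * (4 / w)) = D by rewrite /D /s; ring.
  rewrite ler_pM2l//; apply: (le_trans (ler_norm _)).
  rewrite normrN normrM ler_pM// normrM normfV (gtr0_norm w0).
  by rewrite ler_pM2r ?invr_gt0// dbump_le.
have first0 (x : R) : 0 <= s * ((1 + ((x - c) / h) ^+ 2)^-1 * h^-1 * bump (q x)).
  have /andP[b00 _] := bump_itv (q x).
  rewrite mulr_ge0 ?(ltW s0)// mulr_ge0// mulr_ge0 ?invr_ge0 ?(ltW h0)//.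
  by rewrite addr_ge0// sqr_ge0.
exists psi, phi; split=> //.
- move=> x x01; have [-> _] := E _ x01.
  rewrite /Psi normrM (gtr0_norm s0) normrM.
  have /andP[b00 b01] := bump_itv (q x).
  rewrite (ger0_norm b00) (_ : lam = s * (2 * 1)); last by rewrite /s; field.
  by rewrite ler_pM2l// ler_pM.
- move=> x x01 xd; have [-> _] := E _ x01.
  rewrite /Psi (proj1 (qfar x _)) ?mulr0//.
  by case: xd => /ltW; [left|right].
- move=> x; rewrite -(periodic1_frac x pphi).
  have /andP[y0 /ltW y1] := frac_part_itv x.
  have [_ ->] := E (frac_part x) (ltac:(by rewrite y0)).
  by rewrite /dPsi mulrDr; have := first0 (frac_part x); have := second (frac_part x); lra.
- move=> x xch; have x01 : 0 <= x <= 1 by move: d01 xch; lra.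
  have [_ ->] := E _ x01.
  rewrite /dPsi mulrDr lerD//.
  have u1 : `|(x - c) / h| <= 1.
    rewrite normrM normfV (gtr0_norm h0) ler_pdivrMr// mul1r ler_norml.
    by move: xch; lra.
  have u2 : ((x - c) / h) ^+ 2 <= 1.
    by rewrite -(real_normK (num_real _)) expr_le1.
  have v1 : 2^-1 <= (1 + ((x - c) / h) ^+ 2)^-1.
    rewrite lef_pV2 ?posrE//; first by lra.
    by rewrite ltr_wpDr ?sqr_ge0.
  have qx : `|q x| <= u0.
    rewrite /q /u0 normrM normfV (gtr0_norm w0) ler_pM2r ?invr_gt0//.
    by rewrite ler_norml; move: xch ch1 ch2; lra.
  have q2 : q x ^+ 2 <= u0 ^+ 2.
    rewrite -(real_normK (num_real (q x))) lerXn2r ?nnegrE//.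
    by case/andP: u01 => /ltW.
  have v2 : (1 - u0 ^+ 2) ^+ 2 <= bump (q x).
    rewrite /bump max_r; last by lra.
    by rewrite lerXn2r ?nnegrE; lra.
  have -> : B / h = s * (2^-1 * (1 - u0 ^+ 2) ^+ 2) * h^-1 by rewrite /B /s; ring.
  move: v1; move: (1 + ((x - c) / h) ^+ 2)^-1 => V v1.
  have -> : s * (V * h^-1 * bump (q x)) = s * (V * bump (q x)) * h^-1 by ring.
  by rewrite ler_pM2r ?invr_gt0// ler_pM2l// ler_pM// ltW// exprn_gt0.
Qed.

Lemma prob_Rintegral_indic d (T : measurableType d) (R : realType)
    (P : probability T R) (A : set T) : measurable A ->
  \int[P]_x \1_A x = fine (P A).
Proof.
by move=> mA; rewrite /Rintegral integral_indic// setIT.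
Qed.

(** A null set is covered by intervals of small total length, and each is
    charged at most K times half its length. *)
Lemma null_near_interval (R : realType) (nu : probability (measurableTypeR R) R)
    (delta K : R) : 0 < delta -> 0 <= K ->
  (forall c h : R, 0 < h -> 2 * delta <= c - h -> c + h <= 1 - 2 * delta ->
    (nu `[(c - h)%R, (c + h)%R]%classic <= (K * h)%:E)%E) ->
  forall B : set (measurableTypeR R), measurable B -> lebesgue_measure B = 0%E ->
    nu (B `&` `[3 * delta, 1 - 3 * delta]%classic) = 0%E.
Proof.
move=> d0 K0 bound B mB B0.
set Y := `[3 * delta, 1 - 3 * delta]%classic.
have mY : measurable (Y : set (measurableTypeR R)) by exact: measurable_itv.
apply/eqP; rewrite -measure_le0; apply/lee_addgt0Pr => eta eta0.
(* Total length at most delta: an interval of the cover which meets the target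
   [3 delta, 1 - 3 delta] stays in [2 delta, 1 - 2 delta], where the bound holds. *)
pose x := Num.min delta (eta / (K + 1)).
have K10 : 0 < K + 1 by rewrite ltr_wpDl.
have x0 : 0 < x by rewrite lt_min d0 divr_gt0.
have /ereal_inf_lt[z [/= M' [ocM covM] sMz zx]] : (lebesgue_measure B < x%:E)%E.
  by rewrite B0 lte_fin.
have l0 k : (0 <= wlength idfun (M' k))%E by exact: wlength_ge0.
have lx k : (wlength idfun (M' k) <= x%:E)%E.
  apply: ltW; apply: le_lt_trans zx; rewrite -sMz.
  apply: le_trans (@nneseries_lim_ge _ _ xpredT 0 k.+1 _); last by move=> n _ _.
  by rewrite big_nat_recr//= leeDr// sume_ge0.
have mM k : measurable (M' k : set (measurableTypeR R)).
  by apply: sub_sigma_algebra; exact: ocM.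
have nuM k : (nu (M' k `&` Y) <= (K / 2)%:E * wlength idfun (M' k))%E.
  have /ocitvP[M0|[[a b] /= ab Mab]] := ocM k.
    by rewrite M0 set0I measure0 wlength0 mule0.
  have := lx k; rewrite Mab wlength_itv/= lte_fin ab -EFinB lee_fin => abx.
  have [[y [/= yab yY]]|nY] := pselect ((`]a, b] `&` Y) !=set0); last first.
    have -> : `]a, b]%classic `&` Y = set0.
      by apply/seteqP; split=> // y yY; apply: nY; exists y.
    rewrite measure0 -EFinM lee_fin mulr_ge0 ?divr_ge0// subr_ge0 ltW//.
  have xd : x <= delta by rewrite ge_min lexx.
  move: yab yY; rewrite /Y /= !in_itv/= => /andP[ay yb] /andP[y1 y2].
  have -> : ((K / 2)%:E * (b - a)%:E = (K * ((b - a) / 2))%:E)%E.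
    by rewrite -EFinM; congr (_%:E); field.
  apply: le_trans (bound ((a + b) / 2) ((b - a) / 2) _ _ _); [|lra|lra|lra].
  apply: le_measure; rewrite ?inE.
  - by apply: measurableI => //; exact: measurable_itv.
  - exact: measurable_itv.
  - by move=> u [/= + _]; rewrite !in_itv/=; lra.
rewrite add0e.
apply: (@le_trans _ _ (\sum_(k <oo) nu (M' k `&` Y))%E).
  apply: measure_sigma_subadditive => //.
  - by move=> k; exact: measurableI.
  - exact: measurableI.
  - by rewrite -setI_bigcupl; exact: setSI.
apply: (@le_trans _ _ (\sum_(k <oo) ((K / 2)%:E * wlength idfun (M' k)))%E).
  by apply: lee_nneseries => k _ //; exact: measure_ge0.
rewrite nneseriesZl// sMz.
apply: (@le_trans _ _ ((K / 2)%:E * x%:E)%E).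
  by apply: lee_wpmul2l; [rewrite lee_fin divr_ge0|exact: ltW].
rewrite -EFinM lee_fin.
have xe : x <= eta / (K + 1) by rewrite ge_min lexx orbT.
rewrite -(ler_pM2r K10) in xe; rewrite mulfVK ?gt_eqF// in xe.
by have := mulr_ge0 K0 (ltW x0); lra.
Qed.

Section limit_measures.
Context {R : realType} (alpha : R) (alpha01 : 0 < alpha < 1)
  (theta : R -> probability (measurableTypeR R) R)
  (theta_ac : forall e : R, 0 < e <= 2^-1 -> theta e `<< @lebesgue_measure R)
  (theta_supp : forall e : R, 0 < e <= 2^-1 ->
     measure_support (theta e) `<=` `[- e, e])
  (mu : R -> probability (circle R) R)
  (mu_stat : forall e : R, 0 < e <= 2^-1 ->
     stationary (intermittent_map alpha) (theta e) (mu e))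
  (mu0 : probability (circle R) R)
  (mu0_cluster : cluster ((mu : R -> weak_star R) @ (0 : R)^'+)
     (mu0 : weak_star R)).

Let law_integral (m : probability (circle R) R) (phi : R -> R) :
  continuous phi -> periodic1 phi ->
  \int[circle_law m]_s phi s = \int[m]_z phi (circle_coord z).
Proof.
move=> cphi pphi; have [M _ phiM] := continuous_periodic_bounded cphi pphi.
exact: (Rintegral_circle_law m (measurable_to_R (continuous_measurable_fun cphi)) phiM).
Qed.

(** The constants of [stationary_C1_bound] do not depend on the noise, so the
    bound passes to the limit; it is then compared with B/h - D on the interval. *)
Lemma limit_interval_bound (delta : R) : 0 < delta < 4^-1 ->
  exists2 K : R, 0 <= K & forall c h : R, 0 < h ->
    2 * delta <= c - h -> c + h <= 1 - 2 * delta ->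
    (circle_law mu0 `[(c - h)%R, (c + h)%R]%classic <= (K * h)%:E)%E.
Proof.
move=> d01; have d0 : 0 < delta by case/andP: d01.
have [r [e1 [r01 rd e10 small]]] := small_noise_exists alpha01 d0.
have lam0 : 0 < gain alpha * (delta * pw alpha delta).
  by rewrite mulr_gt0 ?gain_gt0// mulr_gt0// pw_gt0.
have [D [B [D0 B0 test]]] := interval_test_function d01 lam0.
have C0 : 0 <= step_error r.
  by rewrite /step_error addr_ge0// divr_ge0// divr_ge0//; case/andP: r01 => /ltW.
exists ((step_error r + 2 + D) / B).
  by apply: divr_ge0; [exact: addr_ge0 (addr_ge0 C0 (ler0n _ 2)) D0|exact: ltW].
move=> c h h0 ch1 ch2.
have [psi [phi [C1 psi_le psi_supp phiD phiB]]] := test c h h0 ch1 ch2.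
have [_ cphi pphi _] := C1.
have ccirc := continuous_periodic cphi pphi.
have e0 : 0 < Num.min e1 2^-1 by rewrite lt_min e10 invr_gt0 ltr0n.
have [e [/andP[e_gt0 elt] close _]] := weak_star_cluster mu0_cluster ccirc ccirc e0 ltr01.
have ee1 : 0 <= e <= e1.
  by rewrite (ltW e_gt0) (le_trans (ltW elt))// ge_min lexx.
have e2 : e <= 2^-1 by rewrite (le_trans (ltW elt))// ge_min lexx orbT.
have ehalf : 0 < e <= 2^-1 by rewrite e_gt0.
have le1 : e <= 1 by apply: (le_trans e2); lra.
have bound := stationary_C1_bound alpha01 r01 rd (small _ ee1) le1
  (theta_ac ehalf) (support_null (theta_supp ehalf))
  (stationary_circle_law (mu_stat ehalf)) C1 psi_le psi_supp.
rewrite law_integral// in bound.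
have bound0 : \int[circle_law mu0]_s phi s <= step_error r + 2.
  by rewrite law_integral//; move: close bound; rewrite ler_norml; lra.
set I := `[c - h, c + h]%classic.
have mI : measurable (I : set (measurableTypeR R)) by exact: measurable_itv.
pose nu := circle_law mu0; rewrite -/nu.
have finI : nu I \is a fin_num by exact: fin_num_measure.
have iind : nu.-integrable setT (EFin \o (fun x => B / h * \1_I x)).
  apply: (@prob_integrable _ _ _ nu _ (B / h)).
    by apply: measurable_funM => //; exact: measurable_indic.
  move=> x; rewrite normrM ger0_norm ?divr_ge0 ?(ltW B0) ?(ltW h0)//.
  by rewrite ler_piMr ?divr_ge0 ?(ltW B0) ?(ltW h0)// indicE; case: (_ \in _); rewrite ?normr1 ?normr0.
have iind1 : nu.-integrable setT (EFin \o (\1_I : measurableTypeR R -> R)).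
  apply: (@prob_integrable _ _ _ nu _ 1); first exact: measurable_indic.
  by move=> x; rewrite indicE; case: (_ \in _); rewrite ?normr1 ?normr0.
have icst : nu.-integrable setT (EFin \o (fun _ : measurableTypeR R => - D)).
  by apply: (@prob_integrable _ _ _ nu _ `|- D|).
have [M _ phiM] := continuous_periodic_bounded cphi pphi.
have iphi := @prob_integrable _ _ _ nu _ M
  (measurable_to_R (continuous_measurable_fun cphi)) phiM.
have : \int[nu]_s (B / h * \1_I s + - D) <= \int[nu]_s phi s.
  apply: le_Rintegral => //.
    exact: (integrableD measurableT iind icst).
  move=> x _; rewrite indicE; case: (boolP (x \in I)) => [|_].
    by rewrite inE /I/= in_itv/= mulr1 => /phiB.
  by rewrite mulr0 add0r.
rewrite (RintegralD measurableT iind icst) prob_Rintegral_cst.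
rewrite (RintegralZl _ measurableT iind1) (prob_Rintegral_indic nu mI).
move=> le2; rewrite -(fineK finI) lee_fin.
have le3 : B / h * fine (nu I) <= step_error r + 2 + D by move: bound0 le2; rewrite -/nu; lra.
rewrite mulrAC ler_pdivlMr// mulrC -ler_pdivrMr//.
by rewrite mulrAC.
Qed.

End limit_measures.

(** The open interval ]0, 1[ is exhausted by the segments on which
    [null_near_interval] applies. *)
Lemma null_off_zero (R : realType) (nu : probability (measurableTypeR R) R) :
  (forall delta : R, 0 < delta < 4^-1 -> exists2 K : R, 0 <= K &
    forall c h : R, 0 < h -> 2 * delta <= c - h -> c + h <= 1 - 2 * delta ->
    (nu `[(c - h)%R, (c + h)%R]%classic <= (K * h)%:E)%E) ->
  forall B : set (measurableTypeR R), measurable B -> lebesgue_measure B = 0%E ->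
    nu (B `&` `]0, 1[%classic) = 0%E.
Proof.
move=> bound B mB B0.
pose d (n : nat) : R := n.+1%:R^-1 / 5.
have dn n : 0 < d n < 4^-1.
  rewrite /d divr_gt0 ?invr_gt0//= ltr_pdivrMr//.
  have : n.+1%:R^-1 <= 1 :> R by rewrite invf_le1// ler1n.
  by move: (n.+1%:R^-1) => u; lra.
pose F n := B `&` (`[3 * d n, 1 - 3 * d n]%classic : set R).
have mF n : measurable (F n : set (measurableTypeR R)).
  by apply: measurableI => //; exact: measurable_itv.
have F0 n : nu (F n) = 0%E.
  have [K K0 hK] := bound _ (dn n).
  have d0 : 0 < d n by case/andP: (dn n).
  exact: (null_near_interval d0 K0 hK mB B0).
apply/eqP; rewrite -measure_le0.
have m01 : measurable (B `&` `]0, 1[%classic : set (measurableTypeR R)).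
  by apply: measurableI => //; exact: measurable_itv.
have cover : B `&` `]0, 1[%classic `<=` \bigcup_n F n.
  move=> x [Bx /=]; rewrite in_itv/= => /andP[x0 x1].
  pose y := Num.min x (1 - x).
  have y0 : 0 < y by rewrite lt_min x0 subr_gt0.
  have yx : y <= x by rewrite ge_min lexx.
  have yx1 : y <= 1 - x by rewrite ge_min lexx orbT.
  exists (Num.trunc y^-1) => //; split=> //=; rewrite in_itv/=.
  have : (d (Num.trunc y^-1)) * 3 <= y.
    have := ltW (truncnS_gt y^-1).
    rewrite -[X in X <= _ -> _]invrK -[X in _ <= X -> _]invrK.
    rewrite lef_pV2 ?posrE ?invr_gt0 ?invrK// => h.
    by move: h y0; rewrite /d; move: (_.+1%:R^-1) => u; lra.
  by lra.
apply: (@le_trans _ _ (\sum_(n <oo) nu (F n))%E).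
  exact: measure_sigma_subadditive.
by rewrite eseries0// => n _ _; exact: F0.
Qed.

(** * Invariance of the limit measure *)

(** The indicator of an arc is a limit of continuous tent functions, and the
    arcs ]x, 1[ generate the Borel sets. *)
Lemma circle_measure_unique (R : realType) (m1 m2 : probability (circle R) R) :
  (forall phi : R -> R, continuous phi -> periodic1 phi ->
    \int[m1]_z phi (circle_coord z) = \int[m2]_z phi (circle_coord z)) ->
  forall A, measurable A -> m1 A = m2 A.
Proof.
move=> m_eq.
have mfrac : measurable_fun setT (@frac_part R : measurableTypeR R -> R).
  exact: measurable_to_R (@measurable_frac_part R).
have law_frac (m : probability (circle R) R) A :
    circle_law m A = circle_law m (@frac_part R @^-1` A).
  rewrite !circle_lawE; congr (m _); apply/seteqP.
  by split=> z /=; rewrite frac_part_id// circle_coord_itv.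
set P1 := circle_law m1; set P2 := circle_law m2.
have int_eq phi : continuous phi -> periodic1 phi ->
    \int[P1]_s phi s = \int[P2]_s phi s.
  move=> cphi pphi; have [M _ phiM] := continuous_periodic_bounded cphi pphi.
  have mphi := measurable_to_R (continuous_measurable_fun cphi).
  by rewrite !(Rintegral_circle_law _ mphi phiM) m_eq.
have arc (x : R) : 0 <= x < 1 ->
    P1 (@frac_part R @^-1` `]x, 1[) = P2 (@frac_part R @^-1` `]x, 1[).
  move=> x01.
  (* As n grows, the tents increase to the indicator of ]x, 1[. *)
  pose tent (n : nat) (s : R) : R :=
    Num.min 1 (n%:R * Num.max 0 (Num.min (s - x) (1 - s))).
  have ctent n : continuous (tent n) by rewrite /tent; solve_cont.
  have tent0 n : tent n 0 = tent n 1.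
    rewrite /tent; congr (Num.min _ (_ * _)); rewrite !max_l//.
      by rewrite ge_min subrr lexx orbT.
    by rewrite ge_min; apply/orP; left; lra.
  pose phi n s := tent n (frac_part s).
  have cphi n : continuous (phi n) := continuous_frac_extension (@ctent n) (tent0 n).
  have pphi n : periodic1 (phi n).
    by move=> s; rewrite /phi -[X in s + X]/(1%:~R) frac_partDz.
  have tent01 n s : 0 <= tent n s <= 1.
    rewrite /tent le_min ler01 ge_min lexx/= andbT mulr_ge0//.
    by rewrite le_max lexx.
  have lim_arc (P : probability (measurableTypeR R) R) :
      (\int[P]_s (phi n s)%:E)%E @[n --> \oo] --> P (@frac_part R @^-1` `]x, 1[).
    set A := _ @^-1` _.
    have mA : measurable A.
      by rewrite -[A]setTI; apply: mfrac => //; exact: measurable_itv.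
    rewrite -[A]setIT -integral_indic//.
    apply: (@dominated_cvg _ _ _ P setT measurableT
      (fun n s => (phi n s)%:E) _ (cst 1%E)) => //.
    - move=> n; apply/measurable_EFinP.
      exact: measurable_to_R (continuous_measurable_fun (cphi n)).
    - move=> s _; rewrite indicE /phi.
      have [us|us] := leP (frac_part s) x.
        rewrite (_ : s \in A = false); last first.
          by apply/negbTE; rewrite notin_setE /A /= in_itv/= ltNge us.
        apply: cvg_near_cst; near=> n.
        rewrite /tent (max_l _ : Num.max 0 _ = 0); last by rewrite ge_min subr_le0 us.
        by rewrite mulr0 min_r// ler01.
      have /andP[_ u1] := frac_part_itv s.
      rewrite (_ : s \in A = true); last by apply/mem_set; rewrite /A /= in_itv/= us.
      set v := Num.min (frac_part s - x) (1 - frac_part s).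
      have v0 : 0 < v by rewrite lt_min !subr_gt0 us.
      apply: cvg_near_cst; near=> n.
      rewrite /tent -/v max_r ?(ltW v0)// min_l//.
      rewrite -ler_pdivrMr// div1r.
      by near: n; exact: nbhs_infty_ger.
    - exact: finite_measure_integrable_cst.
    - move=> n s _; rewrite abse_EFin lee_fin.
      by have /andP[t0 t1] := tent01 n (frac_part s); rewrite ger0_norm.
  apply: (cvg_unique _ (lim_arc P1)) => //.
  rewrite (_ : (fun n => _) = (fun n => \int[P2]_s (phi n s)%:E)%E); last first.
    apply/funext => n.
    have [M _ phiM] := continuous_periodic_bounded (cphi n) (pphi n).
    have i1 := @prob_integrable _ _ _ P1 _ M
      (measurable_to_R (continuous_measurable_fun (cphi n))) phiM.
    have i2 := @prob_integrable _ _ _ P2 _ M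
      (measurable_to_R (continuous_measurable_fun (cphi n))) phiM.
    have := int_eq _ (cphi n) (pphi n); rewrite /Rintegral => h.
    rewrite -(fineK (integrable_fin_num measurableT i1)) h fineK//.
    exact (integrable_fin_num measurableT i2).
  exact: lim_arc P2.
have ray (x : R) : P1 `]x, +oo[%classic = P2 `]x, +oo[%classic.
  have mray : measurable (`]x, +oo[%classic : set (measurableTypeR R)).
    exact: measurable_itv.
  rewrite /P1 /P2 law_frac (law_frac m2) -/P1 -/P2.
  have [x0|x0] := ltP x 0.
    rewrite (_ : _ @^-1` _ = setT) ?probability_setT//.
    apply/seteqP; split=> // s _ /=; rewrite in_itv/= andbT.
    by rewrite (lt_le_trans x0)//; case/andP: (frac_part_itv s).
  have [x1|x1] := leP 1 x.
    rewrite (_ : _ @^-1` _ = set0) ?measure0//.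
    apply/seteqP; split=> // s /=; rewrite in_itv/= andbT.
    by have /andP[_] := frac_part_itv s; lra.
  rewrite (_ : _ @^-1` _ = @frac_part R @^-1` `]x, 1[) ?arc ?x0//.
  apply/seteqP; split=> s /=; rewrite !in_itv/= andbT; last by case/andP.
  by move=> ->; case/andP: (frac_part_itv s).
move=> C mC.
pose A : set (measurableTypeR R) := circle_proj @^-1` C.
have mA : measurable A.
  by have := measurable_circle_proj measurableT mC; rewrite setTI.
have CA (m : probability (circle R) R) : m C = circle_law m A.
  rewrite circle_lawE; congr (m _); apply/seteqP.
  by split=> z; rewrite /A /= circle_coordK.
rewrite !CA.
refine (@g_sigma_algebra_measure_unique _ R (measurableTypeR R)
  (@RGenOInfty.G R) _ (fun n => `](- n%:R), +oo[%classic) _ _ P1 P2 _ _ _ A _).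
- by move=> _ [x ->]; exact: measurable_itv.
- by move=> n; exists (- n%:R).
- apply/seteqP; split=> // x _.
  exists (Num.trunc `|x|).+1 => //=; rewrite in_itv/= andbT ltrNl.
  by rewrite (le_lt_trans (ler_norm _))// normrN truncnS_gt.
- move=> _ _ [x ->] [y ->]; exists (Num.max x y).
  apply/seteqP; split=> z /=; rewrite !in_itv/= !andbT gt_max.
    by case=> -> ->.
  by case/andP.
- by move=> _ [x ->]; exact: ray.
- by move=> n; rewrite (le_lt_trans (probability_le1 _ _)) ?ltry//; exact: measurable_itv.
- by have := mA; rewrite RGenOInfty.measurableE.
Unshelve. all: by end_near.
Qed.

Lemma measurable_intermittent_map (R : realType) (alpha : R) :
  measurable_fun setT (@intermittent_map R alpha).
Proof.
apply: (measurableT_comp (@measurable_circle_proj R)).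
exact: (measurableT_comp (measurable_intermittent alpha) (@measurable_circle_coord R)).
Qed.

HB.instance Definition _ (R : realType) (alpha : R) :=
  isMeasurableFun.Build _ _ _ _ (@intermittent_map R alpha)
    (measurable_intermittent_map alpha).

(** The values at the junctions 0 and 1/2 are integers, where a periodic
    function takes a single value. *)
Lemma circle_lift_C0 (R : realType) (alpha : R) (phi : R -> R) :
  0 < alpha < 1 -> continuous phi -> periodic1 phi ->
  continuous (fun s => phi (circle_lift alpha s)) /\
  periodic1 (fun s => phi (circle_lift alpha s)).
Proof.
move=> alpha01 cphi pphi.
have cb : continuous (branch alpha) := continuous_branch alpha01.
have cb1 : continuous (fun x => 1 - branch alpha x) by solve_cont.
have b0 : branch alpha 0 = 0 by rewrite /branch mul0r.
have b2 : branch alpha 2^-1 = 1 by rewrite /branch pw_half//; field.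
have phi01 : phi 0 = phi 1 by rewrite -(pphi 0) add0r.
have [||c [cc pc c1 c2]] := continuous_glue (cont_comp cphi cb) (cont_comp cphi cb1).
- by rewrite b0 subr0.
- by rewrite b2 subrr.
have lift_frac s : circle_lift alpha (frac_part s) = circle_lift alpha s.
  by rewrite /circle_lift (frac_part_id (frac_part_itv s)).
suff -> : (fun s => phi (circle_lift alpha s)) = c by [].
apply/funext => s; rewrite -(periodic1_frac s pc) /circle_lift.
have /andP[s0 s1] := frac_part_itv s.
have [s2|s2] := ltP (frac_part s) 2^-1.
  by rewrite intermittent_left ?c1 ?s0// ltW.
by rewrite intermittent_right ?c2 ?s2 ?(ltW s1).
Qed.

Section limit_invariance.
Context {R : realType} (alpha : R) (alpha01 : 0 < alpha < 1)
  (theta : R -> probability (measurableTypeR R) R)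
  (theta_supp : forall e : R, 0 < e <= 2^-1 ->
     measure_support (theta e) `<=` `[- e, e])
  (mu : R -> probability (circle R) R)
  (mu_stat : forall e : R, 0 < e <= 2^-1 ->
     stationary (intermittent_map alpha) (theta e) (mu e))
  (mu0 : probability (circle R) R)
  (mu0_cluster : cluster ((mu : R -> weak_star R) @ (0 : R)^'+)
     (mu0 : weak_star R)).

(** For a small noise level e, the integrals of phi and of phi o T against mu0
    are close to those against mu e; the latter are compared by
    [stationary_shift] and by the uniform continuity of phi.  The reverse
    inequality is the same one for - phi. *)
Lemma limit_integral_le (phi : R -> R) : continuous phi -> periodic1 phi ->
  \int[mu0]_z phi (circle_coord z) <=
  \int[mu0]_z phi (circle_coord (intermittent_map alpha z)).
Proof.
move=> cphi pphi; pose c s := phi (circle_lift alpha s).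
have [cc pc] : continuous c /\ periodic1 c := circle_lift_C0 alpha01 cphi pphi.
have -> : \int[mu0]_z phi (circle_coord (intermittent_map alpha z)) =
    \int[mu0]_z c (circle_coord z).
  by apply: eq_Rintegral => z _; rewrite intermittent_periodic// /c circle_lift_coord.
apply/ler_addgt0Pr => eta eta0; pose h := eta / 4.
have h0 : 0 < h by rewrite divr_gt0.
have [e1 e10 unif] := continuous_periodic_uniform cphi pphi h0.
have e0 : 0 < Num.min e1 2^-1 by rewrite lt_min e10 invr_gt0 ltr0n.
have [e [/andP[e_gt0 elt] close1 close2]] := weak_star_cluster mu0_cluster
  (continuous_periodic cphi pphi) (continuous_periodic cc pc) e0 h0.
have ee1 : e <= e1 by rewrite (le_trans (ltW elt))// ge_min lexx.
have ehalf : 0 < e <= 2^-1.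
  by rewrite e_gt0 (le_trans (ltW elt))// ge_min lexx orbT.
have [M _ phiM] := continuous_periodic_bounded cphi pphi.
have mphi := continuous_measurable_fun cphi.
have mc := continuous_measurable_fun cc.
have [t te le_t] := stationary_shift (measurable_circle_lift alpha)
  (stationary_circle_law (mu_stat ehalf)) (support_null (theta_supp ehalf))
  cphi pphi h0.
have mft : measurable_fun setT (fun s => phi (circle_lift alpha s + t)).
  apply: (measurableT_comp mphi).
  by apply: measurable_funD => //; exact: measurable_circle_lift.
have : `|\int[circle_law (mu e)]_s phi (circle_lift alpha s + t) -
    \int[circle_law (mu e)]_s c s| <= h.
  apply: (@prob_Rintegral_dist _ _ _ _ _ _ M).
  - exact: measurable_to_R.
  - exact: measurable_to_R.
  - by move=> s; exact: phiM.
  - by move=> s; exact: phiM.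
  - by move=> s; apply: unif; exact: le_trans te ee1.
move: le_t.
rewrite (Rintegral_circle_law _ (measurable_to_R mphi) phiM).
rewrite (Rintegral_circle_law _ (measurable_to_R mc) (fun=> phiM _)).
move: close1 close2; rewrite !ler_norml /h; lra.
Qed.

Lemma limit_invariant : invariant_measure (intermittent_map alpha) mu0.
Proof.
move=> A mA.
have dE : distribution mu0 (intermittent_map alpha) A =
  mu0 (intermittent_map alpha @^-1` A) by [].
rewrite -dE; apply: circle_measure_unique mA => phi cphi pphi.
have [M _ phiM] := continuous_periodic_bounded cphi pphi.
have mphi := continuous_measurable_fun cphi.
rewrite (@Rintegral_distribution _ _ _ _ _ mu0 _ (fun z => phi (circle_coord z)) M)//; last first.
  exact: (measurableT_comp mphi (@measurable_circle_coord R)).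
apply/eqP; rewrite eq_le limit_integral_le// andbT.
have mphic := measurableT_comp mphi (@measurable_circle_coord R).
have mphiT := measurableT_comp mphic (measurable_intermittent_map alpha).
have i1 := @prob_integrable _ _ _ mu0 _ M mphic (fun=> phiM _).
have i2 := @prob_integrable _ _ _ mu0 _ M mphiT (fun=> phiM _).
have neg (g : circle R -> R) : mu0.-integrable setT (EFin \o g) ->
    \int[mu0]_z (- g z) = - \int[mu0]_z g z.
  move=> ig; rewrite -mulN1r -(RintegralZl _ measurableT ig).
  by apply: eq_Rintegral => z _; rewrite mulN1r.
have := limit_integral_le (contN cphi) (fun x => congr1 -%R (pphi x)).
by rewrite (neg _ i1) (neg _ i2) lerN2.
Qed.

End limit_invariance.

(** * Decomposition of the limit measure *)

Lemma measurable_circle1 (R : realType) (o : circle R) : measurable [set o].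
Proof.
rewrite (_ : [set o] = @circle_coord R @^-1` [set circle_coord o]).
  rewrite -[X in measurable X]setTI; exact: measurable_circle_coord.
apply/seteqP; split=> z /=; first by move=> ->.
exact: can_inj (@circle_coordK R) z o.
Qed.

(** The point 0 is fixed, so A and its preimage have the same trace on it;
    removing this trace from the invariance of [m] leaves an invariant measure. *)
Lemma off_fixed_point_acip (R : realType) (alpha : R) (halpha : 0 < alpha < 1)
    (m nu : probability (circle R) R) (w : R) :
  invariant_measure (intermittent_map alpha) m ->
  (forall B : set (measurableTypeR R), measurable B -> lebesgue_measure B = 0%E ->
    circle_law m (B `&` `]0, 1[%classic) = 0%E) ->
  (forall A, measurable A -> nu A = (m (A `&` ~` [set circle_proj 0%R]) * w%:E)%E) ->
  acip (intermittent_map alpha) nu.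
Proof.
move=> inv ac; set o := circle_proj (0 : R); set D := ~` [set o] => nuE.
have To : intermittent_map alpha o = o.
  rewrite /intermittent_map circle_coord_proj frac_part_id ?lexx ?ltr01//.
  by rewrite intermittent_left ?lexx ?invr_gt0 ?ltr0n// /branch mul0r.
have mo : measurable [set o] := measurable_circle1 o.
have mD : measurable D by exact: measurableC.
have mT A : measurable A -> measurable (intermittent_map alpha @^-1` A).
  move=> mA; rewrite -[X in measurable X]setTI.
  exact: (@measurable_intermittent_map R alpha).
split.
  move=> A mA; rewrite !nuE//; last exact: mT.
  congr (_ * _)%E.
  have split_o B : measurable B -> m B = (m (B `&` D) + m (B `&` [set o]))%E.
    move=> mB; rewrite -measureU; [|exact: measurableI|exact: measurableI|].
      by rewrite -setIUr setUC setUv setIT.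
    by rewrite setIACA setICl setI0.
  have fin_o : m (A `&` [set o]) \is a fin_num.
    by apply: fin_num_measure; exact: measurableI.
  have := inv _ mA; rewrite (split_o A mA) (split_o _ (mT _ mA)).
  rewrite (_ : _ @^-1` A `&` [set o] = A `&` [set o]).
    by move=> sum_eq; rewrite -[LHS](addeK _ fin_o) sum_eq addeK.
  by apply/seteqP; split=> z [/= + zo]; rewrite zo To.
move=> N N0 A mA AN; rewrite nuE//.
pose B : set (measurableTypeR R) := @circle_proj R @^-1` A `&` `[0, 1]%classic.
have mpA : measurable (@circle_proj R @^-1` A).
  by rewrite -[X in measurable X]setTI; exact: measurable_circle_proj.
have mB : measurable B by apply: measurableI => //; exact: measurable_itv.
have B0 : lebesgue_measure B = 0%E by have := N0 A mA AN.
have -> : A `&` D = @circle_coord R @^-1` (B `&` `]0, 1[%classic).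
  apply/seteqP; split=> z; rewrite /B /= circle_coordK !in_itv/=.
    move=> [Az zo]; have /andP[z0 z1] := circle_coord_itv z.
    suff c0 : 0 < circle_coord z by rewrite z0 c0 z1 (ltW z1).
    rewrite lt_def z0 andbT; apply/eqP => z00; apply: zo.
    by rewrite -(circle_coordK z) z00.
  move=> [[Az _] /andP[z0 _]]; split=> // zo; move: z0.
  by rewrite zo /o circle_coord_proj frac_part_id ?lexx ?ltr01// ltxx.
have := ac _ mB B0; rewrite circle_lawE => ->.
by rewrite mul0e.
Qed.

Lemma mnormalizeE d (T : measurableType d) (R : realType)
    (m : {measure set T -> \bar R}) (P : probability T R) (A : set T) (r : R) :
  m setT = r%:E -> r != 0 -> mnormalize m P A = (m A * r^-1%:E)%E.
Proof. by move=> mT r0; rewrite /mnormalize mT eqe (negbTE r0). Qed.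

Theorem theorem1 (R : realType) (alpha : R) (halpha : 0 < alpha < 1)
    (muSRB : probability (circle R) R)
    (hSRB : unique_acip (intermittent_map alpha) muSRB)
    (theta : R -> probability (measurableTypeR R) R)
    (htheta_ac : forall e : R, 0 < e <= 2^-1 ->
       theta e `<< @lebesgue_measure R)
    (htheta_supp : forall e : R, 0 < e <= 2^-1 ->
       measure_support (theta e) `<=` `[- e, e])
    (mu : R -> probability (circle R) R)
    (hmu : forall e : R, 0 < e <= 2^-1 ->
       stationary (intermittent_map alpha) (theta e) (mu e))
    (mu0 : probability (circle R) R)
    (hmu0 : cluster ((mu : R -> weak_star R) @ (0 : R)^'+)
       (mu0 : weak_star R)) :
  dirac_srb_segment muSRB mu0.
Proof.
set o := circle_proj (0 : R).
have mo : measurable [set o] := measurable_circle1 o.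
have mD : measurable (~` [set o]) by exact: measurableC.
have fo : mu0 [set o] \is a fin_num by exact: fin_num_measure.
have fD : mu0 (~` [set o]) \is a fin_num by exact: fin_num_measure.
pose t := fine (mu0 [set o]).
have tE : mu0 [set o] = t%:E by rewrite fineK.
have DE : mu0 (~` [set o]) = (1 - t)%:E.
  by rewrite (probability_setC mu0 mo) tE -EFinB.
have t01 : 0 <= t <= 1.
  by rewrite -!lee_fin -tE measure_ge0 probability_le1.
have split_o A : measurable A ->
    mu0 A = (t%:E * \d_o A + mu0 (A `&` ~` [set o]))%E.
  move=> mA.
  have {1}-> : A = (A `&` [set o]) `|` (A `&` ~` [set o]).
    by rewrite -setIUr setUv setIT.
  rewrite measureU; [|exact: measurableI|exact: measurableI|]; last first.
    by rewrite setIACA setICr setI0.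
  congr (_ + _)%E; rewrite diracE; case: (boolP (o \in A)) => oA.
    rewrite mule1 -tE; congr (mu0 _); apply/seteqP; split=> z /=; first by case.
    by move=> ->; split=> //; exact: set_mem.
  rewrite mule0 (_ : _ `&` _ = set0) ?measure0//.
  by apply/seteqP; split=> // z [/= Az zo]; move/negP: oA; apply; apply/mem_set; rewrite -zo.
exists t => // A mA; rewrite split_o//; congr (_ + _)%E.
(* If mu0 is the Dirac mass, there is nothing to normalize. *)
have [t1|t1] := eqVneq (1 - t) 0.
  rewrite t1 mul0e; apply/eqP; rewrite -measure_le0.
  have <- : mu0 (~` [set o]) = 0%E by rewrite DE t1.
  by apply: le_measure; rewrite ?inE//; exact: measurableI.
pose nu : probability (circle R) R := mnormalize (mrestr mu0 mD) mu0.
have nuE B : nu B = (mu0 (B `&` ~` [set o]) * (1 - t)^-1%:E)%E.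
  have mass : mrestr mu0 mD setT = (1 - t)%:E by rewrite /mrestr setTI DE.
  exact (mnormalizeE mu0 B mass t1).
have acip_nu : acip (intermittent_map alpha) nu.
  apply: (@off_fixed_point_acip _ alpha halpha mu0 nu (1 - t)^-1).
  - exact (limit_invariant halpha htheta_supp hmu hmu0).
  - exact (null_off_zero
      (limit_interval_bound halpha htheta_ac htheta_supp hmu hmu0)).
  - by move=> B _; exact: nuE.
rewrite -(hSRB.2 _ acip_nu A mA) nuE muleCA -EFinM mulfV// mule1.
by [].
Qed.
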